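(* Let $E$ be an abstract local operator space, that is, a complex vector space equipped with a separating family $\{p_\alpha : \alpha \in \Lambda\}$ of matrix seminorms, $p_\alpha = (p_\alpha^{(n)})_{n\geq 1}$, and the locally convex topology they define (equivalently, $E$ is a projective limit, in the operator space sense, of operator spaces $E_\alpha$, $\alpha\in\Lambda$). Then $E$ has a realization as a concrete local operator space: there exist a family $\{H_\alpha : \alpha\in\Lambda\}$ of complex Hilbert spaces and an injective linear map $\varphi : E \to \prod_{\alpha\in\Lambda} \mathcal{L}(H_\alpha)$ such that $\varphi$ identifies $E$, as a local operator space, with the subspace $\varphi(E)$ carrying the induced structure, i.e. for all $\alpha\in\Lambda$, all $n\geq 1$ and all $(x_{i,j})\in M_n(E)$, $$\rho_\alpha^{(n)}\big[(\varphi(x_{i,j}))\big] = p_\alpha^{(n)}\big[(x_{i,j})\big],$$ where $(\rho_\alpha)_{\alpha\in\Lambda}$ are the canonical matrix seminorms of $\prod_{\alpha\in\Lambda} \mathcal{L}(H_\alpha)$.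
   Context: Matrix seminorms. For a complex vector space $E$, $M_{m,n}(E)$ denotes the space of $m\times n$ matrices with entries in $E$, and $M_n(E)=M_{n,n}(E)$. A matrix seminorm on $E$ is a sequence $p=(p^{(n)})_{n\geq 1}$, where each $p^{(n)}$ is a seminorm on $M_n(E)$, such that for all $m,n\ge 1$: (i) $p^{(m+n)}(x\oplus y)=\max\{p^{(m)}(x),p^{(n)}(y)\}$ for $x\in M_m(E)$, $y\in M_n(E)$, where $x\oplus y$ is the block diagonal matrix; (ii) $p^{(n)}(a x b)\leq \|a\|\,p^{(m)}(x)\,\|b\|$ for $x\in M_m(E)$ and scalar matrices $a\in M_{n,m}(\mathbb{C})$, $b\in M_{m,n}(\mathbb{C})$ (with operator norms). A matrix norm is a matrix seminorm for which each $p^{(n)}$ is a norm. An (abstract) operator space is a Banach space together with a matrix norm whose first level is the norm of the space. Abstract local operator spaces. An abstract local operator space is a locally convex space $E$ with a family $\{p_\alpha:\alpha\in\Lambda\}$ of matrix seminorms whose first levels $p_\alpha^{(1)}$ define the topology of $E$ and which is separating: if $p_\alpha^{(1)}(x)=0$ for all $\alpha$ then $x=0$. In projective limit notation, $E=\varprojlim_\alpha E_\alpha$ means that there are operator spaces $E_\alpha$ and jointly injective linear maps $\pi_\alpha:E\to E_\alpha$ with $p_\alpha^{(n)}[(x_{i,j})]=\|(\pi_\alpha(x_{i,j}))\|_{M_n(E_\alpha)}$. Here subspaces with the induced structure count as projective limits, and no completeness of $E$ is required. Canonical structure on the product. For a Hilbert space $H$, $\mathcal{L}(H)$ is the space of bounded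 linear operators on $H$, with its usual matrix norms, obtained by identifying $M_n(\mathcal{L}(H))$ with $\mathcal{L}(H^n)$, where $H^n$ is the Hilbert space direct sum of $n$ copies of $H$. For a family $\{H_\alpha:\alpha\in\Lambda\}$ of Hilbert spaces, $\prod_{\alpha\in\Lambda}\mathcal{L}(H_\alpha)$ is the full Cartesian product (no uniform boundedness imposed), with matrix seminorms $$\rho_\alpha^{(n)}\big[(T_{i,j})\big]=\big\|\big((T_{i,j})_\alpha\big)\big\|_{M_n(\mathcal{L}(H_\alpha))},\qquad \alpha\in\Lambda,\ n\geq 1,$$ where $(T_{i,j})_\alpha\in\mathcal{L}(H_\alpha)$ is the $\alpha$-th coordinate of $T_{i,j}$. A concrete local operator space is a linear subspace of some $\prod_{\alpha\in\Lambda}\mathcal{L}(H_\alpha)$ with the matrix seminorms obtained by restricting the $\rho_\alpha$. *)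

(* Defs.v *)
From HB Require Import structures.
From mathcomp Require Import all_boot all_order all_algebra.
From mathcomp Require Import sesquilinear complex.
From mathcomp Require Import all_classical all_reals topology normedtype.

Set Implicit Arguments.
Unset Strict Implicit.
Unset Printing Implicit Defensive.

Import Order.TTheory GRing.Theory Num.Theory.
Import numFieldNormedType.Exports.

Local Open Scope classical_set_scope.
Local Open Scope ring_scope.

HB.mixin Record CompleteNormedModule_isHilbert (R : realType) H
    & CompleteNormedModule R[i] H := {
  (* linear in the first variable, conjugate-linear in the second *)
  inner : {dot H for @Num.conj R[i]} ;
  inner_norm : forall x : H, inner x x = `|x| ^+ 2
}.

#[short(type="hilbertType")]
HB.structure Definition Hilbert (R : realType) :=
  {H of CompleteNormedModule R[i] H & CompleteNormedModule_isHilbert R H}.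

Section operator_norm.
Variable R : realType.

(* The norm of the l^2 direct sum of n copies of V, with values in R: the
   library norm of a normedModType R[i] takes its values in R[i]. *)
Definition sumnorm (V : normedModType R[i]) n (v : 'cV[V]_n) : R :=
  Num.sqrt (\sum_(i < n) complex.Re `|v i 0| ^+ 2).

Definition opnorm (V W : normedModType R[i]) m n
    (f : 'cV[V]_m -> 'cV[W]_n) : R :=
  sup [set sumnorm (f v) | v in [set v | sumnorm v <= 1]].

Definition scalar_opnorm m n (a : 'M[R[i]]_(m, n)) : R :=
  @opnorm R[i]^o R[i]^o n m (fun v => a *m v).

End operator_norm.

Section bounded_operators.
Variables (R : realType) (H : hilbertType R).

Definition bounded_linear : {pred H -> H} :=
  fun T => `[< linear T /\ exists M : R[i], forall x, `|T x| <= M * `|x| >].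

Lemma bounded_linear_submod_closed : submod_closed bounded_linear.
Proof.
split=> [|a S T /asboolP[lS [M SM]] /asboolP[lT [N TN]]]; apply/asboolP; split.
- by move=> c x y /=; rewrite scaler0 addr0.
- by exists 0 => x; rewrite normr0 mul0r.
- move=> c x y; rewrite -[LHS]/(a *: S (c *: x + y) + T (c *: x + y)).
  rewrite -[RHS]/(c *: (a *: S x + T x) + (a *: S y + T y)) lS lT !scalerDr.
  by rewrite !scalerA mulrC addrACA.
- exists (`|a| * M + N) => x; rewrite -[X in `|X|]/(a *: S x + T x).
  rewrite (le_trans (ler_normD _ _))// normrZ mulrDl -mulrA.
  by rewrite lerD// ler_wpM2l.
Qed.

HB.instance Definition _ :=
  GRing.isSubmodClosed.Build R[i] (H -> H) bounded_linear
    bounded_linear_submod_closed.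

Record boundedOp := BoundedOp {
  boundedOp_fun :> H -> H ;
  boundedOpP : boundedOp_fun \in bounded_linear }.

HB.instance Definition _ := [isSub for boundedOp_fun].
HB.instance Definition _ := [Choice of boundedOp by <:].
HB.instance Definition _ := [SubChoice_isSubLmodule of boundedOp by <:].

(* M_n(L(H)) is identified with L(H^n) by letting a matrix of operators act on
   the columns of H^n. *)
Definition boundedOp_mx_app n (T : 'M[boundedOp]_n) (v : 'cV[H]_n) : 'cV[H]_n :=
  \col_i \sum_(j < n) T i j (v j 0).

Definition boundedOp_mxnorm n (T : 'M[boundedOp]_n) : R :=
  opnorm (boundedOp_mx_app T).

End bounded_operators.

Section dependent_product.
Variables (K : pzRingType) (I : Type) (V : I -> lmodType K).

Definition lmodProd : Type := forall i, V i.

HB.instance Definition _ := Choice.on lmodProd.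

Implicit Types f g h : lmodProd.

Let prod0 : lmodProd := fun=> 0.
Let prodD f g : lmodProd := fun i => f i + g i.
Let prodN f : lmodProd := fun i => - f i.
Let prodZ (c : K) f : lmodProd := fun i => c *: f i.

Let prodDA : associative prodD.
Proof. by move=> f g h; apply: functional_extensionality_dep => i; apply: addrA. Qed.

Let prodDC : commutative prodD.
Proof. by move=> f g; apply: functional_extensionality_dep => i; apply: addrC. Qed.

Let prod0D : left_id prod0 prodD.
Proof. by move=> f; apply: functional_extensionality_dep => i; apply: add0r. Qed.

Let prodND : left_inverse prod0 prodN prodD.
Proof. by move=> f; apply: functional_extensionality_dep => i; apply: addNr. Qed.

HB.instance Definition _ :=
  GRing.isZmodule.Build lmodProd prodDA prodDC prod0D prodND.

Let prodZA c d f : prodZ c (prodZ d f) = prodZ (c * d) f.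
Proof. by apply: functional_extensionality_dep => i; apply: scalerA. Qed.

Let prodZ1 : left_id 1 prodZ.
Proof. by move=> f; apply: functional_extensionality_dep => i; apply: scale1r. Qed.

Let prodZDr : right_distributive prodZ +%R.
Proof. by move=> c f g; apply: functional_extensionality_dep => i; apply: scalerDr. Qed.

Let prodZDl f : {morph prodZ^~ f : c d / c + d}.
Proof. by move=> c d; apply: functional_extensionality_dep => i; apply: scalerDl. Qed.

HB.instance Definition _ :=
  GRing.Zmodule_isLmodule.Build K lmodProd prodZA prodZ1 prodZDr prodZDl.

End dependent_product.

Definition boundedOpProd (R : realType) (Lambda : Type)
    (H : Lambda -> hilbertType R) : lmodType R[i] :=
  lmodProd (fun alpha => boundedOp (H alpha)).

Definition rho (R : realType) (Lambda : Type) (H : Lambda -> hilbertType R)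
    (alpha : Lambda) n (T : 'M[boundedOpProd H]_n) : R :=
  boundedOp_mxnorm (\matrix_(i, j) T i j alpha).

Section matrix_seminorms.
Variable R : realType.

(* The product a x b of an E-valued matrix x with scalar matrices a and b. *)
Definition bimulmx (E : lmodType R[i]) n m k l
    (a : 'M[R[i]]_(n, m)) (x : 'M[E]_(m, k)) (b : 'M[R[i]]_(k, l)) :
    'M[E]_(n, l) :=
  \matrix_(i, j) \sum_(r < m) \sum_(s < k) (a i r * b s j) *: x r s.

(* p 0 is a dummy: the levels of the sequence are the p n with n >= 1. *)
Record matrix_seminorm (E : lmodType R[i]) (p : forall n, 'M[E]_n -> R) :
    Prop := MatrixSeminorm {
  mxsn_ge0 : forall n (x : 'M[E]_n), (0 < n)%N -> 0 <= p n x ;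
  mxsnD : forall n (x y : 'M[E]_n), (0 < n)%N -> p n (x + y) <= p n x + p n y ;
  mxsnZ : forall n (c : R[i]) (x : 'M[E]_n), (0 < n)%N ->
    p n (map_mx ( *:%R c) x) = complex.Re `|c| * p n x ;
  mxsn_sum : forall m n (x : 'M[E]_m) (y : 'M[E]_n), (0 < m)%N -> (0 < n)%N ->
    p (m + n)%N (block_mx x 0 0 y) = Num.max (p m x) (p n y) ;
  mxsn_bimul : forall m n (a : 'M[R[i]]_(n, m)) (x : 'M[E]_m)
      (b : 'M[R[i]]_(m, n)), (0 < m)%N -> (0 < n)%N ->
    p n (bimulmx a x b) <= scalar_opnorm a * p m x * scalar_opnorm b }.

Record local_operator_space (E : tvsType R[i]) (Lambda : Type)
    (p : Lambda -> forall n, 'M[E]_n -> R) : Prop := LocalOperatorSpace {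
  los_mxsn : forall alpha, matrix_seminorm (p alpha) ;
  los_separating : forall x : E,
    (forall alpha, p alpha 1%N (const_mx x) = 0) -> x = 0 ;
  los_nbhs : forall (x : E) (U : set E), nbhs x U <->
    exists (A : set Lambda) (e : R), [/\ finite_set A, 0 < e &
      [set y | forall alpha, A alpha -> p alpha 1%N (const_mx (y - x)) < e]
        `<=` U] }.

End matrix_seminorms.

(* Main.v *)
Require Import Defs.
From HB Require Import structures.
From mathcomp Require Import all_boot all_order all_algebra.
From mathcomp Require Import sesquilinear spectral complex.
From mathcomp Require Import all_classical all_reals topology normedtype.
From mathcomp Require Import finmap showcase.summability.
From mathcomp Require Import ring lra.

(** Each matrix seminorm p is represented on its own Hilbert space; the product
over the index set and the separation hypothesis then give the theorem.

For one p, the Hilbert space is the l2-sum of all the spaces C^d, one summand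
for each linear map phi from E to the d by d matrices that is completely
contractive with respect to p, and x acts on that summand as phi x. Complete
contractivity makes this representation completely contractive, so everything
rests on [norming_complete_contraction]: for every n and every n by n matrix x0
over E there is such a phi, with d = n, for which the matrix (phi (x0 i j)) has
norm at least p x0.

The map phi comes from a duality argument. By the axioms of a matrix seminorm,
p (c^* x b) <= (s + t) / 2 as soon as p x <= 1, c^* c <= s and b^* b <= t; and a
finite family of such triples (c, x, b) can be assembled into a single one, with
x block diagonal and c, b stacked. Hence the triples (c^* c, c^* x b, b^* b) span
a convex cone to which the Hahn-Banach theorem applies. The functional obtained
consists of positive functionals P and Q on the n by n matrices and of a
functional F on the n by n matrices over E with
  Re F (c^* x b) <= (P (c^* c) + Q (b^* b)) / 2  whenever p x <= 1,
  P 1 <= 1,  Q 1 <= 1,  p x0 <= Re F x0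
([dominating_forms]). This avoids both the compactness of the state space and a
minimax argument. The Gram matrices of P and Q factor as T T^* and S S^*, and the
form F, read through the pseudo-inverses of T and S, is the matrix phi x
([norming_complete_contraction]).

Hahn-Banach is used in the form [strict_cone_functional]: a convex cone in V * R
that contains points above every vector and no point below 0 lies above the
graph of a real linear functional; Zorn's lemma is applied to the cones
themselves, so no functional on a subspace has to be extended. *)

Set Implicit Arguments.
Unset Strict Implicit.
Unset Printing Implicit Defensive.

Import Order.TTheory GRing.Theory Num.Theory.
Import numFieldNormedType.Exports.

Local Open Scope classical_set_scope.
Local Open Scope ring_scope.

(** * Dominated linear functionals *)

Definition scalar_of (K : pzRingType) (U : lmodType K) (f : U -> K)
    (fL : scalar f) : {scalar U} :=
  HB.pack f (GRing.isLinear.Build K U K *%R f fL).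

Definition linear_of (K : pzRingType) (U V : lmodType K) (f : U -> V)
    (fL : linear f) : {linear U -> V} :=
  HB.pack f (GRing.isLinear.Build K U V *:%R f fL).

Section complexification.
Variables (R : realType) (V : lmodType R[i]).
Local Notation "c %:C" := (real_complex R c).

(** A real linear functional f on a complex vector space is the real part of the
complex linear functional v |-> f v - i f (i v). *)
Lemma real_part_scalar (f : V -> R) : {morph f : v w / v + w} ->
    (forall (c : R) v, f (c%:C *: v) = c * f v) ->
  exists g : {scalar V}, forall v, complex.Re (g v) = f v.
Proof.
move=> fD fZ; pose g v := Complex (f v) (- f (Complex 0 1 *: v)).
have g_lin : scalar g.
  move=> [a b] v w; rewrite /g.
  have cE : Complex a b = a%:C + Complex 0 1 * b%:C by simpc.
  have icE : Complex 0 1 * Complex a b = a%:C * Complex 0 1 + (- b)%:C by simpc.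
  rewrite scalerDr scalerA icE cE !scalerDl -!scalerA !fD !fZ.
  rewrite [in LHS](_ : Complex 0 1 *: _ = b%:C *: (Complex 0 1 *: v)); last first.
    by rewrite !scalerA mulrC.
  rewrite !fZ; apply/eqP; rewrite eq_complex /=; apply/andP; split; apply/eqP; ring.
by exists (scalar_of g_lin).
Qed.

End complexification.

Section hahn_banach.
Variables (R : realType) (V : lmodType R[i]).
Local Notation "c %:C" := (real_complex R c).

(** The typical example is the epigraph of a sublinear functional. As a cone need
not be closed, it can be described by its elements, without an infimum. *)
Record strict_cone (K : set (V * R)) : Prop := StrictCone {
  scone0 : K (0, 0) ;
  sconeD : forall v w s t, K (v, s) -> K (w, t) -> K (v + w, s + t) ;
  sconeZ : forall (c : R) v t, 0 < c -> K (v, t) -> K (c%:C *: v, c * t) ;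
  scone_ge0 : forall t, K (0, t) -> 0 <= t }.

Lemma strict_cone_max (K : set (V * R)) : strict_cone K ->
  exists A, [/\ K `<=` A, strict_cone A &
                forall B, A `<=` B -> strict_cone B -> B `<=` A].
Proof.
move=> coneK.
pose P := [set A | A = set0 \/ K `<=` A /\ strict_cone A].
(* The empty set is admitted because it is the union of the empty chain. *)
have [F FP Ftot|A [PA maxA]] := @Zorn_bigcup _ P.
  have [[X FX [x Xx]]|F0] := pselect (exists2 X, F X & X !=set0); last first.
    left; apply/seteqP; split=> // x [X FX Xx]; apply: F0.
    by exists X => //; exists x.
  have FG Y y : F Y -> Y y -> K `<=` Y /\ strict_cone Y.
    by move=> /FP[-> //|].
  have [KX coneX] := FG X x FX Xx; right; split.
    by move=> y /KX Xy; exists X.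
  split.
  - by exists X => //; exact: (scone0 coneX).
  - move=> v w s t [Y FY Yv] [Z FZ Zw].
    have [YZ|ZY] := Ftot _ _ FY FZ.
      by exists Z => //; apply: (sconeD (FG Z _ FZ Zw).2) => //; exact: YZ.
    by exists Y => //; apply: (sconeD (FG Y _ FY Yv).2) => //; exact: ZY.
  - move=> c v t c0 [Y FY Yv]; exists Y => //.
    by apply: (sconeZ (FG Y _ FY Yv).2).
  - by move=> t [Y FY Yt]; exact: (scone_ge0 (FG Y _ FY Yt).2).
have [KA coneA] : K `<=` A /\ strict_cone A.
  case: PA => // A0; exfalso; apply: (maxA K); last by right; split.
  by rewrite A0; split; [exact: sub0set|move=> /(_ _ (scone0 coneK))].
exists A; split=> // B AB coneB; apply: contrapT => BA.
by apply: (maxA B) => //; right; split=> //; exact: subset_trans AB.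
Qed.

(** A maximal strict cone A is the epigraph of a linear functional. Its lower
boundary q is sublinear, and the ray through (-v, - q v) can be added to A
without losing strictness, since q v is the least height of A above v. By
maximality the ray lies in A already, which forces q (- v) = - q v; a sublinear
odd functional is linear. *)
Theorem strict_cone_functional (K : set (V * R)) : strict_cone K ->
    (forall v, exists t, K (v, t)) ->
  exists g : {scalar V}, forall v t, K (v, t) -> complex.Re (g v) <= t.
Proof.
move=> /strict_cone_max[A [KA coneA maxA]] Kfull.
pose q v := inf [set t | A (v, t)].
have Afull v : exists t, A (v, t) by have [t /KA] := Kfull v; exists t.
have A_ge v s t : A (- v, s) -> A (v, t) -> - s <= t.
  move=> As At; rewrite -subr_ge0 opprK addrC; apply: (scone_ge0 coneA).
  by rewrite -(addNr v); exact: sconeD.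
have qinf v : has_inf [set t | A (v, t)].
  split; first by have [t] := Afull v; exists t.
  by have [s As] := Afull (- v); exists (- s) => t; exact: A_ge.
have q_le v t : A (v, t) -> q v <= t by move=> At; apply: ge_inf => //; case: (qinf v).
(* B is A with the ray through (- v, - q v) added. *)
have AN v : A (- v, - q v).
  pose B := [set w : V * R | exists2 c : R, 0 <= c & A (w.1 + c%:C *: v, w.2 + c * q v)].
  apply: (maxA B); last first.
  - by exists 1; rewrite ?ler01//= scale1r mul1r !addNr; exact: scone0.
  - split=> [|u w s t [c c0 Ac] [d d0 Ad]|c u t c0 [d d0 Ad]|t [c]].
    + by exists 0 => //=; rewrite scale0r mul0r !addr0; exact: scone0.
    + exists (c + d); first exact: addr_ge0.
      by rewrite /= rmorphD scalerDl mulrDl addrACA [X in (_, X)]addrACA; exact: sconeD.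
    + exists (c * d); first by rewrite mulr_ge0// ltW.
      by rewrite /= rmorphM -scalerA -mulrA -scalerDr -mulrDr; exact: sconeZ.
    + rewrite le_eqVlt => /predU1P[<-|c0]/=.
        by rewrite scale0r mul0r !addr0; exact: scone_ge0.
      rewrite add0r => Ac.
      have ci : 0 < c^-1 by rewrite invr_gt0.
      have := sconeZ coneA ci Ac.
      rewrite scalerA -rmorphM mulVf ?gt_eqF// scale1r => /q_le.
      by rewrite mulrDr mulKf ?gt_eqF// lerDr pmulr_rge0.
  - by move=> [w s] Aw; exists 0 => //=; rewrite scale0r mul0r !addr0.
have qN v : q (- v) = - q v.
  apply/le_anti/andP; split; first exact: q_le.
  rewrite lerNl; apply: lb_le_inf; first by case: (qinf v).
  move=> t At; rewrite lerNl; apply: lb_le_inf; first by case: (qinf (- v)).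
  by move=> s As; rewrite lerNl; exact: A_ge As At.
have Aq v : A (v, q v) by have := AN (- v); rewrite qN !opprK.
have qD_le v w : q (v + w) <= q v + q w by apply: q_le; exact: sconeD.
have qD : {morph q : v w / v + w}.
  move=> v w; apply/le_anti/andP; split=> //.
  by have := qD_le (- v) (- w); rewrite -opprD !qN -opprD lerN2.
have qZ_pos (c : R) v : 0 < c -> q (c%:C *: v) = c * q v.
  move=> c0; apply/le_anti/andP; split; first by apply: q_le; exact: sconeZ.
  have ci : 0 < c^-1 by rewrite invr_gt0.
  have := q_le _ _ (sconeZ coneA ci (Aq (c%:C *: v))).
  by rewrite scalerA -rmorphM mulVf ?gt_eqF// scale1r ler_pdivlMl.
have q0 : q 0 = 0 by apply: (addIr (q 0)); rewrite -qD !add0r.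
have qZ (c : R) v : q (c%:C *: v) = c * q v.
  case: (ltgtP c 0) => [c0|c0|->]; last by rewrite scale0r q0 mul0r.
  - apply: oppr_inj; rewrite -qN -scaleNr -rmorphN qZ_pos ?mulNr//.
    by rewrite oppr_gt0.
  - exact: qZ_pos.
have [g gE] := real_part_scalar qD qZ.
by exists g => v t /KA /q_le; rewrite gE.
Qed.

End hahn_banach.

(** * Positive semidefinite matrices and the Cauchy-Schwarz inequality *)

Section positive_matrices.
Variable C : numClosedFieldType.
Local Open Scope sesquilinear_scope.
Local Notation "''[' u , v ]" := (dotmx u v) : ring_scope.
Local Notation "''[' u ]" := '[u, u]%R : ring_scope.

Lemma dotmx_adjr m n (u : 'rV[C]_m) (v : 'rV[C]_n) (A : 'M[C]_(m, n)) :
  '[u *m A, v] = '[u, v *m A ^t*].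
Proof. by rewrite !dotmxE trmx_mul map_mxM trmxCK mulmxA. Qed.

Lemma dotmxDl n (u v w : 'rV[C]_n) : '[u + v, w] = '[u, w] + '[v, w].
Proof. exact: linearDl. Qed.

Lemma dotmxNl n (u w : 'rV[C]_n) : '[- u, w] = - '[u, w].
Proof. exact: linearNl. Qed.

Lemma dotmxZl n (a : C) (u w : 'rV[C]_n) : '[a *: u, w] = a * '[u, w].
Proof. exact: linearZl_LR. Qed.

Lemma dotmxC n (u v : 'rV[C]_n) : '[u, v] = '[v, u]^*.
Proof. by have := hermC (@dotmx C n) u v; rewrite expr0 mul1r. Qed.

Lemma dotmxZr n (a : C) (u w : 'rV[C]_n) : '[w, a *: u] = a^* * '[w, u].
Proof. exact: linearZr_LR. Qed.

Lemma dotmx_sqD n (u v : 'rV[C]_n) :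
  '[u + v] = '[u] + '[v] + ('[u, v] + '[u, v]^*).
Proof. exact: (dnormD (@dotmx C n)). Qed.

Lemma dotmx_suml n I (r : seq I) (P : pred I) (F : I -> 'rV[C]_n) w :
  '[\sum_(i <- r | P i) F i, w] = \sum_(i <- r | P i) '[F i, w].
Proof. exact: linear_sumlz. Qed.

Lemma dotmx_sum n (u : 'rV[C]_n) : '[u] = \sum_k `|u 0 k| ^+ 2.
Proof. by rewrite dotmxE mxE; apply: eq_bigr => k _; rewrite !mxE normCK. Qed.

Lemma delta_form m n (A : 'M[C]_(m, n)) k l :
  (('e_k : 'rV_m) *m A *m ('e_l : 'rV_n) ^t*) 0 0 = A k l.
Proof. by rewrite trmx_delta map_delta_mx -rowE -colE !mxE. Qed.

(** Polarization: u G v^* + v G u^* is real, and so is its analogue with i v in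
place of v. *)
Lemma psd_hermitian n (G : 'M[C]_n) :
  (forall v : 'rV[C]_n, 0 <= '[v *m G, v]) -> G \is hermsymmx.
Proof.
move=> Gpos; have Greal v : '[v *m G, v] \is Num.real by rewrite ger0_real.
pose B u v := '[u *m G, v].
have BD u v w z : B (u + w) (v + z) = B u v + B u z + (B w v + B w z).
  by rewrite /B mulmxDl linearDl/= !linearDr.
have B_herm u v : B u v = (B v u)^*.
  have s1 : B u v + B v u \is Num.real.
    have -> : B u v + B v u = B (u + v) (u + v) - B u u - B v v by rewrite BD; ring.
    by rewrite !rpredB ?Greal.
  have s2 : - ('i * B u v) + 'i * B v u \is Num.real.
    have -> : - ('i * B u v) + 'i * B v u =
        B (u + 'i *: v) (u + 'i *: v) - B u u - B ('i *: v) ('i *: v).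
      rewrite BD [B u ('i *: v)]/B [B ('i *: v) u]/B -scalemxAl.
      rewrite linearZl_LR linearZr_LR/= conjCi /B; ring.
    by rewrite !rpredB ?Greal.
  have i0 : 'i != 0 :> C by exact: neq0Ci.
  move: s1 s2 => /CrealP s1 /CrealP s2; move: s1 s2.
  rewrite !rmorphD rmorphN !rmorphM/= conjCi => s1 s2.
  have {}s2 : (B u v)^* - (B v u)^* = B v u - B u v.
    apply: (mulfI i0); rewrite mulrBr [in RHS]mulrBr.
    transitivity (- (- 'i * (B u v)^*) + - 'i * (B v u)^*); first by ring.
    by rewrite s2; ring.
  apply: (@mulfI _ 2%:R); first by rewrite pnatr_eq0.
  transitivity ((B u v + B v u) - (B v u - B u v)); first by ring.
  by rewrite -s1 -s2; ring.
apply/is_hermitianmxP; rewrite expr0 scale1r; apply/matrixP => i j.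
have := B_herm 'e_i 'e_j; rewrite /B !dotmxE.
by rewrite !delta_form !mxE.
Qed.

(** If G = P^* D P with P unitary and D diagonal, T is P^* sqrt D and W is its
pseudo-inverse (sqrt D)^-1 P. As 0 is its own inverse, W T is the projection onto
the nonzero diagonal entries, also when G is singular. *)
Lemma psd_factor n (G : 'M[C]_n) : (forall v : 'rV[C]_n, 0 <= '[v *m G, v]) ->
  exists T W : 'M[C]_n, [/\ T *m T ^t* = G, T *m W *m T = T &
    forall v : 'rV[C]_n, '[v *m W *m T] <= '[v]].
Proof.
move=> Gpos; have /psd_hermitian/hermitian_normalmx/orthomx_spectralP GE := Gpos.
move: (spectralmx G) (spectral_diag G) (spectral_unitarymx G) GE => P d PU.
rewrite invmx_unitary// => GE.
have PK : P *m P ^t* = 1%:M by exact/unitarymxP.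
have d_ge0 k : 0 <= d 0 k.
  have := Gpos (row k P); suff -> : '[row k P *m G, row k P] = d 0 k by [].
  rewrite dotmxE GE !rowE !mulmxA trmx_mul map_mxM !mulmxA.
  rewrite -(mulmxA 'e_k P) PK mulmx1 -(mulmxA ('e_k *m _) P) PK mulmx1.
  by rewrite delta_form mxE eqxx mulr1n.
pose s : 'rV[C]_n := \row_k sqrtC (d 0 k).
pose s' : 'rV[C]_n := \row_k (sqrtC (d 0 k))^-1.
have s_real : (diag_mx s) ^t* = diag_mx s.
  apply/matrixP => i j; rewrite !mxE eq_sym.
  case: eqVneq => [->|_]; last by rewrite mulr0n rmorph0.
  by rewrite mulr1n; apply/CrealP; rewrite ger0_real// sqrtC_ge0.
have ss's : diag_mx s *m diag_mx s' *m diag_mx s = diag_mx s.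
  rewrite !mulmx_diag; congr diag_mx; apply/rowP => k; rewrite !mxE.
  have [->|s0] := eqVneq (sqrtC (d 0 k)) 0; first by rewrite !mul0r.
  by rewrite mulfV// mul1r.
exists (P ^t* *m diag_mx s), (diag_mx s' *m P); split.
- rewrite trmx_mul map_mxM s_real trmxCK mulmxA -(mulmxA (P ^t*)) mulmx_diag GE.
  congr (_ *m diag_mx _ *m _); apply/rowP => k.
  by rewrite !mxE -expr2 sqrtCK.
- rewrite !mulmxA -[X in X *m diag_mx s](mulmxA _ P) PK mulmx1.
  by rewrite -!mulmxA [X in _ *m X]mulmxA ss's.
- move=> v; rewrite !mulmxA -[X in X *m diag_mx s](mulmxA _ P) PK mulmx1.
  rewrite !dotmx_sum ler_sum// => k _; rewrite lerXn2r ?nnegrE//.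
  rewrite -mulmxA mulmx_diag mxE (bigD1 k)//= big1 => [|j jk]; last first.
    by rewrite !mxE (negbTE jk) mulr0n mulr0.
  rewrite addr0 !mxE eqxx mulr1n normrM ler_piMr//.
  have [->|s0] := eqVneq (sqrtC (d 0 k)) 0; first by rewrite mulr0 normr0.
  by rewrite mulVf// normr1.
Qed.

End positive_matrices.

Section cauchy_schwarz.
Variables (C : numClosedFieldType) (U : lmodType C) (form : {dot U for @Num.conj C}).
Local Notation "''[' u , v ]" := (form u%R v%R) : ring_scope.
Local Notation "''[' u ]" := '[u, u]%R : ring_scope.

Lemma dot_cauchy_schwarz u v : `|'[u, v]| ^+ 2 <= '[u] * '[v].
Proof.
have [->|v0] := eqVneq v 0; first by rewrite !linear0r normr0 expr0n/= mulr0.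
have v_gt0 : 0 < '[v] by rewrite dnorm_gt0.
have v_ge0 := ltW v_gt0; have v_real := ger0_real v_ge0.
have := dnorm_ge0 form ('[v] *: u - '[u, v] *: v).
rewrite dnormB !dnormZ linearZl_LR linearZr_LR/=.
rewrite ger0_norm// normCK !rmorphM/= conjCK (CrealP v_real).
have -> : '[v] ^+ 2 * '[u] + '[u, v] * '[u, v]^* * '[v] -
    ('[v] * ('[u, v]^* * '[u, v]) + '[v] * ('[u, v] * '[u, v]^*)) =
  '[v] * ('[u] * '[v] - '[u, v] * '[u, v]^*) by ring.
by rewrite pmulr_rge0// subr_ge0.
Qed.

Lemma sqrt_dnorm_triangle u v :
  sqrtC '[u + v] <= sqrtC '[u] + sqrtC '[v].
Proof.
rewrite -(@ler_pXn2r _ 2)// ?nnegrE ?addr_ge0 ?sqrtC_ge0 ?dnorm_ge0//.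
rewrite sqrtCK sqrrD !sqrtCK dnormD addrAC lerD2r lerD2l.
have d_real : '[u, v] + '[u, v]^* \is Num.real.
  by apply/CrealP; rewrite rmorphD/= conjCK addrC.
apply: (le_trans (real_ler_norm d_real)); apply: (le_trans (ler_normD _ _)).
rewrite norm_conjC -mulr2n lerMn2r/=.
rewrite -(@ler_pXn2r _ 2)// ?nnegrE ?mulr_ge0 ?sqrtC_ge0 ?dnorm_ge0//.
by rewrite exprMn !sqrtCK dot_cauchy_schwarz.
Qed.

End cauchy_schwarz.

(** * Euclidean norms and operator norms of scalar matrices *)

Section real_part.
Variable R : realType.
Local Notation re := (@complex.Re R).
Local Notation im := (@complex.Im R).
Local Notation "c %:C" := (real_complex R c).

Lemma reD (z w : R[i]) : re (z + w) = re z + re w.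
Proof. by case: z w => [? ?] [? ?]. Qed.

Lemma reN (z : R[i]) : re (- z) = - re z.
Proof. by case: z. Qed.

Lemma reB (z w : R[i]) : re (z - w) = re z - re w.
Proof. by rewrite reD reN. Qed.

Lemma re_sum (I : Type) (r : seq I) (P : pred I) (F : I -> R[i]) :
  re (\sum_(i <- r | P i) F i) = \sum_(i <- r | P i) re (F i).
Proof. exact: (big_morph re reD erefl). Qed.

Lemma reZ (c : R) (z : R[i]) : re (c%:C * z) = c * re z.
Proof. by case: z => a b /=; rewrite mul0r subr0. Qed.

Lemma re_ge0 (z : R[i]) : 0 <= z -> 0 <= re z.
Proof. by rewrite lecE => /andP[]. Qed.

Lemma reK_ge0 (z : R[i]) : 0 <= z -> (re z)%:C = z.
Proof. by move=> z0; apply/RRe_real/ger0_real. Qed.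

Lemma le_re (z w : R[i]) : z <= w -> re z <= re w.
Proof. by rewrite lecE => /andP[]. Qed.

Lemma conj_realC (c : R) : Num.conj (c%:C) = c%:C :> R[i].
Proof. exact: conjc_real. Qed.

(** The squared Euclidean norm, with values in the real field: inequalities between
norms are proved there, by real arithmetic. *)
Definition sqn n (v : 'rV[R[i]]_n) : R := re (dotmx v v).

Lemma sqnE n (v : 'rV[R[i]]_n) : dotmx v v = (sqn v)%:C.
Proof. by rewrite /sqn reK_ge0// dnorm_ge0. Qed.

Lemma re_dotmxZr n (c : R) (u v : 'rV[R[i]]_n) :
  re (dotmx u (c%:C *: v)) = c * re (dotmx u v).
Proof. by rewrite dotmxZr conj_realC reZ. Qed.

Lemma sqnD n (u v : 'rV[R[i]]_n) :
  sqn (u + v) = sqn u + sqn v + 2 * re (dotmx u v).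
Proof.
rewrite /sqn dotmx_sqD.
by case: (dotmx u u) (dotmx v v) (dotmx u v) => [a ?] [b ?] [c ?] /=; ring.
Qed.

Lemma sqn_ge0 n (v : 'rV[R[i]]_n) : 0 <= sqn v.
Proof. exact/re_ge0/dnorm_ge0. Qed.

Lemma sqn0 n : sqn (0 : 'rV[R[i]]_n) = 0.
Proof. by rewrite /sqn linear0r. Qed.

Lemma sqnZ n (c : R) (v : 'rV[R[i]]_n) : sqn (c%:C *: v) = c ^+ 2 * sqn v.
Proof.
rewrite /sqn dnormZ; suff -> : `|c%:C| ^+ 2 = (c ^+ 2)%:C :> R[i] by rewrite reZ.
by rewrite -add_Re2_Im2 /= expr0n addr0.
Qed.

Lemma sqnZ_complex n (a : R[i]) (v : 'rV[R[i]]_n) :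
  sqn (a *: v) = re (`|a| ^+ 2) * sqn v.
Proof. by rewrite /sqn dotmxZl dotmxZr mulrA -normCK sqnE mulrC reZ mulrC. Qed.

Lemma sqn_sum n (v : 'rV[R[i]]_n) : sqn v = \sum_k re (`|v 0 k|) ^+ 2.
Proof.
rewrite /sqn dotmx_sum re_sum; apply: eq_bigr => k _.
by rewrite -{1}(reK_ge0 (normr_ge0 _)) -rmorphXn.
Qed.

Lemma sqn_delta n (k : 'I_n) : sqn (delta_mx 0 k) = 1.
Proof. by rewrite /sqn dotmxE -[X in X *m _]mulmx1 delta_form mxE eqxx. Qed.

Lemma sqn_conj n (v : 'rV[R[i]]_n) : sqn (map_mx Num.conj v) = sqn v.
Proof. by rewrite !sqn_sum; apply: eq_bigr => k _; rewrite mxE norm_conjC. Qed.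

Lemma sqn_coord n (v : 'rV[R[i]]_n) :
  sqn v = \sum_k (re (v 0 k) ^+ 2 + im (v 0 k) ^+ 2).
Proof.
rewrite /sqn dotmx_sum re_sum; apply: eq_bigr => k _.
by rewrite -add_Re2_Im2.
Qed.

Lemma sqn_coord_le n (v : 'rV[R[i]]_n) k :
  re (v 0 k) ^+ 2 <= sqn v /\ im (v 0 k) ^+ 2 <= sqn v.
Proof.
rewrite sqn_coord (bigD1 k)//=.
have : 0 <= \sum_(l < n | l != k) (re (v 0 l) ^+ 2 + im (v 0 l) ^+ 2).
  by apply: sumr_ge0 => l _; rewrite addr_ge0 ?sqr_ge0.
have := sqr_ge0 (re (v 0 k)); have := sqr_ge0 (im (v 0 k)).
by move: (_ ^+ 2) (_ ^+ 2) (\sum_(_ | _) _) => a b c; split; lra.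
Qed.

Lemma sumnorm_sqn n (v : 'cV[R[i]^o]_n) : sumnorm v = Num.sqrt (sqn v^T).
Proof. by rewrite /sumnorm sqn_sum; under [in RHS]eq_bigr do rewrite mxE. Qed.

(** The expansion of the squared norm of u - s v. *)
Lemma sqn_polar n (u v : 'rV[R[i]]_n) (s : R) :
  2 * s * re (dotmx u v) <= sqn u + s ^+ 2 * sqn v.
Proof.
have := sqn_ge0 (u + (- s)%:C *: v); rewrite sqnD sqnZ sqrrN re_dotmxZr.
by move: (sqn u) (sqn v) (re _) => a b c; lra.
Qed.

Lemma sqnD_le n (u v : 'rV[R[i]]_n) : sqn (u + v) <= 2 * sqn u + 2 * sqn v.
Proof.
have := sqn_polar u v 1; rewrite sqnD mulr1 expr1n mul1r.
by move: (sqn u) (sqn v) (re _) => a b c; lra.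
Qed.

Lemma cauchy_schwarz_sqn n (u v : 'rV[R[i]]_n) :
  re (dotmx u v) ^+ 2 <= sqn u * sqn v.
Proof.
have : `|dotmx u v| ^+ 2 <= dotmx u u * dotmx v v.
  exact: (dot_cauchy_schwarz (@dotmx R[i] n)).
rewrite !sqnE -rmorphM => /le_re; apply: le_trans.
by rewrite -add_Re2_Im2/= lerDl sqr_ge0.
Qed.

(** A matrix and its adjoint have the same operator norm: for w = v a^*, the square
of |w|^2 = Re <w a, v> is at most t |w|^2 |v|^2. *)
Lemma sqn_adj_le m n (a : 'M[R[i]]_(m, n)) (t : R) : 0 <= t ->
    (forall v : 'rV_m, sqn (v *m a) <= t * sqn v) ->
  forall v : 'rV_n, sqn (v *m (a ^t* )%sesqui) <= t * sqn v.
Proof.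
move=> t0 at_le v; set w := v *m _; have [->|w0] := eqVneq (sqn w) 0.
  by rewrite mulr_ge0// sqn_ge0.
have w_gt0 : 0 < sqn w by rewrite lt_neqAle sqn_ge0 andbT eq_sym.
have wE : sqn w = re (dotmx (w *m a) v) by rewrite dotmx_adjr.
rewrite -(ler_pM2l w_gt0) -expr2 {1}wE.
apply: (le_trans (cauchy_schwarz_sqn _ _)).
by rewrite mulrCA mulrA ler_wpM2r ?sqn_ge0.
Qed.

Lemma opnorm_ge0 (U W : normedModType R[i]) m n (f : 'cV[U]_m -> 'cV[W]_n) :
  0 <= opnorm f.
Proof.
rewrite /opnorm; set S := [set _ | _ in _].
have [supS|/sup_out->//] := pselect (has_sup S).
case: (supS) => -[y Sy] _; apply: le_trans (sup_upper_bound supS Sy).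
by case: Sy => v _ <-; exact: sqrtr_ge0.
Qed.

(** Scalar matrices act on columns in the operator norm, whereas the estimates of
this development are about rows; hence the transpose. *)
Lemma scalar_opnorm_le m n (a : 'M[R[i]]_(m, n)) (t : R) : 0 <= t ->
    (forall v : 'rV_n, sqn (v *m a^T) <= t * sqn v) ->
  scalar_opnorm a <= Num.sqrt t.
Proof.
move=> t0 at_le; rewrite /scalar_opnorm /opnorm; apply: ge_sup.
  exists 0, 0; last by rewrite mulmx0 sumnorm_sqn trmx0 sqn0 sqrtr0.
  by rewrite /= sumnorm_sqn trmx0 sqn0 sqrtr0 ler01.
move=> _ [v /= + <-]; rewrite !sumnorm_sqn => v1.
rewrite trmx_mul ler_sqrt// (le_trans (at_le _))// ler_piMr//.
by move: v1; rewrite -[X in _ <= X]sqrtr1 ler_sqrt.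
Qed.

End real_part.

(** * Matrix seminorms *)

Section matrix_seminorm_theory.
Variables (R : realType) (E : lmodType R[i]) (p : forall n, 'M[E]_n -> R).
Hypothesis hp : matrix_seminorm p.
Local Notation "c %:C" := (real_complex R c).
Local Notation zmulmx c := (map_mx ( *:%R c)).

(** A sum of two products a x b is a single product, whose middle factor is block
diagonal: with the direct sum axiom, this is the source of convexity. *)
Lemma bimulmx_block n r1 r2 l (a1 : 'M[R[i]]_(n, r1)) (a2 : 'M_(n, r2))
    (x1 : 'M[E]_r1) (x2 : 'M[E]_r2) (b1 : 'M_(r1, l)) (b2 : 'M_(r2, l)) :
  bimulmx (row_mx a1 a2) (block_mx x1 0 0 x2) (col_mx b1 b2) =
  bimulmx a1 x1 b1 + bimulmx a2 x2 b2.
Proof.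
apply/matrixP => i j; rewrite !mxE big_split_ord/=.
congr (_ + _); apply: eq_bigr => k _; rewrite big_split_ord/=.
  rewrite [X in _ + X]big1 ?addr0 => [|s _].
    by apply: eq_bigr => s _; rewrite row_mxEl col_mxEu block_mxEul.
  by rewrite block_mxEur [X in _ *: X]mxE scaler0.
rewrite [X in X + _]big1 ?add0r => [|s _].
  by apply: eq_bigr => s _; rewrite row_mxEr col_mxEd block_mxEdr.
by rewrite block_mxEdl [X in _ *: X]mxE scaler0.
Qed.

Lemma bimulmxZ n m k l (c d : R[i]) (a : 'M_(n, m)) (x : 'M[E]_(m, k)) (b : 'M_(k, l)) :
  bimulmx (c *: a) x (d *: b) = zmulmx (c * d) (bimulmx a x b).
Proof.
apply/matrixP => i j; rewrite !mxE scaler_sumr; apply: eq_bigr => r _.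
rewrite scaler_sumr; apply: eq_bigr => s _.
by rewrite !mxE scalerA mulrACA.
Qed.

Lemma bimulmx0 n m k l (a : 'M_(n, m)) (b : 'M_(k, l)) :
  bimulmx a (0 : 'M[E]_(m, k)) b = 0.
Proof.
apply/matrixP => i j; rewrite !mxE big1// => r _; rewrite big1// => s _.
by rewrite mxE scaler0.
Qed.

Lemma bimulmxN n m k l (a : 'M_(n, m)) (x : 'M[E]_(m, k)) (b : 'M_(k, l)) :
  bimulmx a (- x) b = - bimulmx a x b.
Proof.
apply/matrixP => i j; rewrite !mxE -sumrN; apply: eq_bigr => r _.
by rewrite -sumrN; apply: eq_bigr => s _; rewrite mxE scalerN.
Qed.

Lemma zmulmxN1 n (x : 'M[E]_n) : zmulmx (-1) x = - x.
Proof. by apply/matrixP => i j; rewrite !mxE scaleN1r. Qed.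

Lemma zmulmx1 n (x : 'M[E]_n) : zmulmx 1 x = x.
Proof. by apply/matrixP => i j; rewrite !mxE scale1r. Qed.

Lemma zmulmx0 n (x : 'M[E]_n) : zmulmx 0 x = 0.
Proof. by apply/matrixP => i j; rewrite !mxE scale0r. Qed.

Lemma zmulmxD n (c : R[i]) (x y : 'M[E]_n) :
  zmulmx c (x + y) = zmulmx c x + zmulmx c y.
Proof. by apply/matrixP => i j; rewrite !mxE scalerDr. Qed.

Lemma zmulmxA n (c d : R[i]) (x : 'M[E]_n) :
  zmulmx (c * d) x = zmulmx c (zmulmx d x).
Proof. by apply/matrixP => i j; rewrite !mxE scalerA. Qed.

Lemma mxsnZ_real n (c : R) (x : 'M[E]_n) : (0 < n)%N -> 0 <= c ->
  p (zmulmx c%:C x) = c * p x.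
Proof. by move=> n0 c0; rewrite (mxsnZ hp)// ger0_norm ?lecR. Qed.

Lemma mxsn0 n : (0 < n)%N -> p (0 : 'M[E]_n) = 0.
Proof. by move=> n0; rewrite -(zmulmx0 0) mxsnZ_real// mul0r. Qed.

Lemma mxsnN n (x : 'M[E]_n) : (0 < n)%N -> p (- x) = p x.
Proof. by move=> n0; rewrite -zmulmxN1 (mxsnZ hp)// normrN1 mul1r. Qed.

(** The bimodule axiom bounds the left-hand side by sqrt s * sqrt t; the arithmetic
mean is what can be linearized. *)
Lemma mxsn_bimul_le m n (a : 'M[R[i]]_(n, m)) (x : 'M[E]_m) (b : 'M[R[i]]_(m, n))
    (s t : R) : (0 < m)%N -> (0 < n)%N -> 0 <= s -> 0 <= t -> p x <= 1 ->
    (forall v : 'rV_m, sqn (v *m a^T) <= s * sqn v) ->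
    (forall v : 'rV_n, sqn (v *m b^T) <= t * sqn v) ->
  p (bimulmx a x b) <= (s + t) / 2.
Proof.
move=> m0 n0 s0 t0 px1 /(scalar_opnorm_le s0) ha /(scalar_opnorm_le t0) hb.
have snorm_ge0 k l (c : 'M[R[i]]_(k, l)) : 0 <= scalar_opnorm c.
  exact: opnorm_ge0.
apply: (le_trans (mxsn_bimul hp _ _ _ m0 n0)).
apply: (@le_trans _ _ (Num.sqrt s * Num.sqrt t)).
  apply: ler_pM => //; first by rewrite mulr_ge0// (mxsn_ge0 hp).
  by rewrite -[Num.sqrt s]mulr1 ler_pM// (mxsn_ge0 hp).
rewrite -subr_ge0 -{1}(sqr_sqrtr s0) -{1}(sqr_sqrtr t0).
have -> : (Num.sqrt s ^+ 2 + Num.sqrt t ^+ 2) / 2 - Num.sqrt s * Num.sqrt t =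
  (Num.sqrt s - Num.sqrt t) ^+ 2 / 2 by field.
by rewrite divr_ge0// sqr_ge0.
Qed.

End matrix_seminorm_theory.

(** * The cone of a matrix seminorm *)

Section dominating_states.
Variables (R : realType) (E : lmodType R[i]) (p : forall n, 'M[E]_n -> R).
Hypothesis hp : matrix_seminorm p.
Variables (n : nat) (x0 : 'M[E]_n).
Hypothesis n_gt0 : (0 < n)%N.
Local Open Scope sesquilinear_scope.
Local Notation re := (@complex.Re R).
Local Notation "c %:C" := (real_complex R c).
Local Notation zmulmx c := (map_mx ( *:%R c)).

(** Only the hermitian part of A is bounded. As A ranges over all matrices, the cone
below lives in a complex vector space. *)
Definition numrange_le (A : 'M[R[i]]_n) (t : R) : Prop :=
  forall v : 'rV_n, re (dotmx (v *m A) v) <= t * sqn v.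

Let V : lmodType R[i] := ('M[R[i]]_n * {ffun 'I_n * 'I_n -> E} * 'M[R[i]]_n)%type.
Let Emx (Y : {ffun 'I_n * 'I_n -> E}) : 'M[E]_n := \matrix_(i, j) Y (i, j).

(** The epigraph, above (A, Y, B), of the infimum of
  (t1 + t2) / 2 + p (Y + tau x0 + c^* x b) - tau (p x0)
over tau >= 0, p x <= 1, A + c^* c <= t1 and B + b^* b <= t2. A functional below it
is bounded by (t1 + t2) / 2 on pairs A <= t1, B <= t2, is nonnegative on the
vectors (c^* c, c^* x b, b^* b), and takes at x0 a value of at least p x0, because
of the term in tau. *)
Definition ruan_cone : set (V * R) := [set w |
  exists r (c b : 'M[R[i]]_(r, n)) (x : 'M[E]_r) (tau t1 t2 : R),
  [/\ (0 < r)%N, 0 <= tau, p x <= 1,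
      numrange_le (w.1.1.1 + c ^t* *m c) t1 /\ numrange_le (w.1.2 + b ^t* *m b) t2 &
      (t1 + t2) / 2 + p (Emx w.1.1.2 + zmulmx tau%:C x0 + bimulmx (c ^t*) x b)
        - tau * p x0 <= w.2]].

Lemma numrange_leD A B s t :
  numrange_le A s -> numrange_le B t -> numrange_le (A + B) (s + t).
Proof.
by move=> As Bt v; rewrite mulmxDr linearDl reD mulrDl; exact: lerD (As v) (Bt v).
Qed.

Lemma numrange_leZ (c : R) A t : 0 <= c ->
  numrange_le A t -> numrange_le (c%:C *: A) (c * t).
Proof.
by move=> c0 At v; rewrite -scalemxAr linearZl_LR/= reZ -mulrA; exact: ler_wpM2l (At v).
Qed.

Lemma numrange_le_gram r (c : 'M[R[i]]_(r, n)) t : numrange_le (c ^t* *m c) t ->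
  0 <= t /\ forall v : 'rV_n, sqn (v *m c ^t*) <= t * sqn v.
Proof.
move=> ct; have cs v : sqn (v *m c ^t*) <= t * sqn v.
  by have := ct v; rewrite mulmxA dotmx_adjr.
split=> //; have := cs (delta_mx 0 (Ordinal n_gt0)).
rewrite sqn_delta mulr1.
by apply: le_trans; exact: sqn_ge0.
Qed.

(** Summing over the matrix units, |A i j| bounds the contribution of each entry. *)
Lemma numrange_bounded A : exists t, numrange_le A t.
Proof.
rewrite [A]matrix_sum_delta.
elim/big_ind: _ => [|B D [s Bs] [t Dt]|i _].
- by exists 0 => v; rewrite mulmx0 linear0l mul0r.
- by exists (s + t); exact: numrange_leD.
elim/big_ind: _ => [|B D [s Bs] [t Dt]|j _].
- by exists 0 => v; rewrite mulmx0 linear0l mul0r.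
- by exists (s + t); exact: numrange_leD.
exists (re `|A i j|) => v.
have -> : dotmx (v *m (A i j *: delta_mx i j)) v = A i j * (v 0 i * (v 0 j)^*).
  rewrite -scalemxAr linearZl_LR/= dotmxE mxE (bigD1 j)//= big1 ?addr0.
    rewrite !mxE (bigD1 i)//= big1 ?addr0 ?mxE ?eqxx ?mulr1// => k /negbTE ki.
    by rewrite mxE ki mulr0.
  move=> k /negbTE kj; rewrite !mxE big1 ?mul0r// => l _.
  by rewrite mxE kj andbF mulr0.
set z := A i j * _.
have zle : re z <= re `|z|.
  by apply: (le_trans (ler_norm _)); have := le_re (normc_ge_Re z).
apply: (le_trans zle); rewrite !normrM norm_conjC.
have nE (w : R[i]) : `|w| = (re `|w|)%:C by rewrite reK_ge0.
rewrite (nE (A i j)) (nE (v 0 i)) (nE (v 0 j)) -!rmorphM.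
have a0 : 0 <= re `|A i j| by exact/re_ge0/normr_ge0.
apply: (ler_wpM2l a0).
have sq_le k : re `|v 0 k| ^+ 2 <= sqn v.
  by rewrite sqn_sum (bigD1 k)//= lerDl sumr_ge0// => l _; exact: sqr_ge0.
have := sqr_ge0 (re `|v 0 i| - re `|v 0 j|); have := sq_le i; have := sq_le j.
by move: (re `|v 0 i|) (re `|v 0 j|) => x y; nra.
Qed.

Lemma ruan_cone_full v : exists t, ruan_cone (v, t).
Proof.
have [t1 t1P] := numrange_bounded v.1.1; have [t2 t2P] := numrange_bounded v.2.
exists ((t1 + t2) / 2 + p (Emx v.1.2)), 1%N, 0, 0, 0, 0, t1, t2; split.
- by [].
- exact: lexx.
- by rewrite (mxsn0 hp).
- by rewrite /= !mulmx0 !addr0.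
- by rewrite /= bimulmx0 rmorph0 zmulmx0 mul0r !addr0 subr0.
Qed.

(** Stability under sums is the block construction; scaling by a multiplies c and b
by the square root of a. Strictness is where the axioms of p enter: above
(0, 0, 0), p (tau x0 + c^* x b) is at least tau (p x0) - p (c^* x b), and
p (c^* x b) <= (t1 + t2) / 2. *)
Lemma ruan_cone_strict : strict_cone ruan_cone.
Proof.
split.
- exists 1%N, 0, 0, 0, 0, 0, 0; split=> //.
  + by rewrite (mxsn0 hp).
  + by split=> v; rewrite /= !mulmx0 addr0 mulmx0 linear0l mul0r.
  + rewrite /= bimulmx0 rmorph0 zmulmx0 mul0r !addr0 subr0 mul0r add0r.
    rewrite [Emx _](_ : _ = 0) ?(mxsn0 hp)//.
    by apply/matrixP => i j; rewrite !mxE ffunE.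
- move=> v w s t.
  move=> [r [c [b [x [tau [t1 [t2 [r0 tau0 x1 [ct bt] ps]]]]]]]].
  move=> [r' [c' [b' [x' [tau' [t1' [t2' [r0' tau0' x1' [ct' bt'] ps']]]]]]]].
  exists (r + r')%N, (col_mx c c'), (col_mx b b'), (block_mx x 0 0 x').
  exists (tau + tau'), (t1 + t1'), (t2 + t2'); split.
  + by rewrite addn_gt0 r0.
  + exact: addr_ge0.
  + by rewrite (mxsn_sum hp)// ge_max x1.
  + rewrite /= !tr_col_mx !map_row_mx !mul_row_col.
    by split; rewrite addrACA; exact: numrange_leD.
  + rewrite /= tr_col_mx map_row_mx bimulmx_block.
    rewrite (_ : Emx _ + _ + _ =
      (Emx v.1.2 + zmulmx tau%:C x0 + bimulmx (c ^t*) x b) +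
      (Emx w.1.2 + zmulmx tau'%:C x0 + bimulmx (c' ^t*) x' b')); last first.
      rewrite [RHS]addrACA; congr (_ + _); rewrite [RHS]addrACA; congr (_ + _).
        by apply/matrixP => i j; rewrite !mxE ffunE.
      by apply/matrixP => i j; rewrite !mxE rmorphD scalerDl.
    have := mxsnD hp (Emx v.1.2 + zmulmx tau%:C x0 + bimulmx (c ^t*) x b)
      (Emx w.1.2 + zmulmx tau'%:C x0 + bimulmx (c' ^t*) x' b') n_gt0.
    move: ps ps' => /=; lra.
- move=> a v s a0 [r [c [b [x [tau [t1 [t2 [r0 tau0 x1 [ct bt] ps]]]]]]]].
  have sa : (Num.sqrt a)%:C * (Num.sqrt a)%:C = a%:C.
    by rewrite -rmorphM -expr2 sqr_sqrtr// ltW.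
  have adjZ (d : 'M[R[i]]_(r, n)) :
      ((Num.sqrt a)%:C *: d) ^t* = (Num.sqrt a)%:C *: d ^t*.
    by rewrite linearZ/= map_mxZ/= conj_realC.
  exists r, ((Num.sqrt a)%:C *: c), ((Num.sqrt a)%:C *: b), x, (a * tau), (a * t1), (a * t2).
  split=> //.
  + by rewrite mulr_ge0// ltW.
  + by split; rewrite /= adjZ -scalemxAl -scalemxAr scalerA sa -scalerDr;
      apply: numrange_leZ => //; exact: ltW.
  + rewrite /= adjZ bimulmxZ sa.
    rewrite (_ : Emx _ + _ + _ = zmulmx a%:C
      (Emx v.1.2 + zmulmx tau%:C x0 + bimulmx (c ^t*) x b)); last first.
      rewrite !zmulmxD rmorphM zmulmxA; congr (_ + _ + _).
      by apply/matrixP => i j; rewrite !mxE ffunE.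
    rewrite (mxsnZ_real hp)//; last exact: ltW.
    move: ps; rewrite /= -(ler_pM2l a0); lra.
- move=> t [r [c [b [x [tau [t1 [t2 [r0 tau0 x1 [ct bt] ps]]]]]]]].
  move: ct bt ps; rewrite /= !add0r (_ : Emx 0 = 0); last first.
    by apply/matrixP => i j; rewrite !mxE ffunE.
  rewrite add0r => /numrange_le_gram[t1_ge0 ct] /numrange_le_gram[t2_ge0 bt].
  set z := bimulmx _ _ _; set y := zmulmx _ _ => ps.
  have pz : p z <= (t1 + t2) / 2.
    apply: (mxsn_bimul_le hp r0 n_gt0 t1_ge0 t2_ge0 x1) => v.
      rewrite map_trmx trmxK -sqn_conj -[X in _ <= _ * X]sqn_conj map_mxM map_mxCK.
      by have := sqn_adj_le t1_ge0 ct (map_mx Num.conj v); rewrite trmxCK.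
    rewrite -sqn_conj -[X in _ <= _ * X]sqn_conj map_mxM.
    exact: bt.
  have py : p y = tau * p x0 by rewrite (mxsnZ_real hp).
  have := mxsnD hp (y + z) (- z) n_gt0; rewrite addrK mxsnN// py.
  by move: ps pz; lra.
Qed.

Lemma ruan_cone_tau0 (A : 'M[R[i]]_n) (Y : {ffun 'I_n * 'I_n -> E}) (B : 'M[R[i]]_n)
    r (c b : 'M[R[i]]_(r, n)) (x : 'M[E]_r) t1 t2 : (0 < r)%N -> p x <= 1 ->
    numrange_le (A + c ^t* *m c) t1 -> numrange_le (B + b ^t* *m b) t2 ->
  Emx Y + bimulmx (c ^t*) x b = 0 -> ruan_cone ((A, Y, B), (t1 + t2) / 2).
Proof.
move=> r0 x1 At Bt Yx; exists r, c, b, x, 0, t1, t2; split.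
- exact: r0.
- exact: lexx.
- exact: x1.
- by split.
- by rewrite /= rmorph0 zmulmx0 addr0 Yx (mxsn0 hp)// mul0r subr0 addr0.
Qed.

Lemma numrange_le0 : numrange_le 0 0.
Proof. by move=> v; rewrite mulmx0 linear0l mul0r. Qed.

End dominating_states.

(** * Positive functionals and the dominated form *)

Section gram_matrices.
Variables (R : realType) (n : nat).
Local Open Scope sesquilinear_scope.
Local Notation re := (@complex.Re R).

(** The indices are exchanged so that the form v |-> v (gram L) v^* on row vectors
is the value of L at v^* v. *)
Definition gram (L : 'M[R[i]]_n -> R[i]) : 'M[R[i]]_n :=
  \matrix_(l, k) L (delta_mx k l).

Lemma gramE (L : {scalar 'M[R[i]]_n}) r (b c : 'M[R[i]]_(r, n)) :
  \sum_i dotmx (row i b *m gram L) (row i c) = L (c ^t* *m b).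
Proof.
rewrite [X in L X]matrix_sum_delta linear_sum/=.
under [RHS]eq_bigr => k _ do rewrite linear_sum/=.
under eq_bigr => i _ do rewrite dotmxE mxE.
rewrite exchange_big/=; apply: eq_bigr => k _.
under eq_bigr => i _ do rewrite !mxE mulr_suml.
rewrite exchange_big/=; apply: eq_bigr => l _.
rewrite linearZ/= !mxE mulr_suml; apply: eq_bigr => i _.
by rewrite !mxE; ring.
Qed.

(** L is nonnegative at v^* v because it is nonpositive at - v^* v; it is real there
because it is nonpositive at both i v^* v and - i v^* v, whose hermitian parts
vanish. *)
Lemma gram_psd (L : {scalar 'M[R[i]]_n}) :
    (forall A, numrange_le A 0 -> re (L A) <= 0) ->
  forall v : 'rV_n, 0 <= dotmx (v *m gram L) v.
Proof.
move=> Lneg v; have := gramE L v v; rewrite big_ord1 !row_id => ->.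
set A := v ^t* *m v.
have AE (w : 'rV_n) : dotmx (w *m A) w = (sqn (w *m v ^t*))%:C%C.
  by rewrite mulmxA dotmx_adjr sqnE.
have iA (s : R[i]) : re s = 0 -> re (s * L A) <= 0.
  move=> s0; rewrite -[s * L A]linearZ; apply: Lneg => w.
  rewrite -scalemxAr dotmxZl AE mul0r.
  by case: s s0 => a b /= ->; rewrite mul0r mulr0 subr0.
have h1 := iA (Complex 0 1) erefl; have h2 := iA (Complex 0 (-1)) erefl.
have h3 : 0 <= re (L A).
  rewrite -oppr_le0 -reN -linearN; apply: Lneg => w.
  by rewrite mulmxN dotmxNl AE /= mul0r oppr_le0 sqn_ge0.
move: h1 h2 h3; case: (L A) => a b /=; rewrite !mul0r !mul1r !sub0r mulN1r opprK.
by rewrite lecE /= oppr_le0 => b0 b0' ->; rewrite andbT eq_le b0 b0'.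
Qed.

End gram_matrices.

Section dominating_forms.
Variables (R : realType) (E : lmodType R[i]) (p : forall n, 'M[E]_n -> R).
Hypothesis hp : matrix_seminorm p.
Variables (n : nat) (x0 : 'M[E]_n).
Hypothesis n_gt0 : (0 < n)%N.
Local Open Scope sesquilinear_scope.
Local Notation re := (@complex.Re R).
Local Notation "c %:C" := (real_complex R c).

(** The value at the matrix c^* x b of the functional whose restriction to the
matrices over E with a single entry z, at position (k, l), is (M z) l k. *)
Definition mxform (M : E -> 'M[R[i]]_n) r (x : 'M[E]_r) (b c : 'M[R[i]]_(r, n)) : R[i] :=
  \sum_i \sum_j dotmx (row j b *m M (x i j)) (row i c).

(** The value at c^* c of the functional with Gram matrix G. *)
Definition diagform (G : 'M[R[i]]_n) r (c : 'M[R[i]]_(r, n)) : R :=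
  \sum_i re (dotmx (row i c *m G) (row i c)).

(** The functional given by Hahn-Banach for [ruan_cone], split into its components
on A, Y and B and expressed by matrices. The components on A and B are doubled,
so that they are at most 1 at the identity matrix. *)
Lemma dominating_forms : exists (M : E -> 'M[R[i]]_n) (GP GQ : 'M[R[i]]_n),
  [/\ linear M,
      (forall v : 'rV_n, 0 <= dotmx (v *m GP) v) /\
      (forall v : 'rV_n, 0 <= dotmx (v *m GQ) v),
      diagform GP 1%:M <= 1 /\ diagform GQ 1%:M <= 1,
      forall r (x : 'M[E]_r) (b c : 'M[R[i]]_(r, n)), (0 < r)%N -> p x <= 1 ->
        re (mxform M x b c) <= (diagform GP c + diagform GQ b) / 2 &
      p x0 <= re (mxform M x0 1%:M 1%:M)].
Proof.
have [g gK] := strict_cone_functional (ruan_cone_strict hp x0 n_gt0)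
  (ruan_cone_full hp x0).
have g_comp (U : lmodType R[i]) (a : R[i]) (h : U -> _) :
    linear h -> scalar (fun u => a * g (h u)).
  by move=> h_lin c u v; rewrite h_lin linearD linearZ/= mulrDr mulrCA.
have inP : linear (fun A : 'M[R[i]]_n =>
    (A, 0, 0) : 'M_n * {ffun 'I_n * 'I_n -> E} * 'M_n).
  by move=> a A B; congr (_, _, _); rewrite /= scaler0 addr0.
have inQ : linear (fun B : 'M[R[i]]_n =>
    (0, 0, B) : 'M_n * {ffun 'I_n * 'I_n -> E} * 'M_n).
  by move=> a A B; congr (_, _, _); rewrite /= scaler0 addr0.
have inF : linear (fun Y : {ffun 'I_n * 'I_n -> E} =>
    (0, Y, 0) : 'M[R[i]]_n * _ * 'M[R[i]]_n).
  by move=> a A B; congr (_, _, _); rewrite /= scaler0 addr0.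
have pD := g_comp _ 2%:R _ inP; have qD := g_comp _ 2%:R _ inQ.
have fD := g_comp _ 1 _ inF.
pose P := scalar_of pD; pose Q := scalar_of qD; pose F := scalar_of fD.
have re2 (z : R[i]) : re (2%:R * z) = 2 * re z.
  by rewrite -[2%:R : R[i]](rmorph_nat (real_complex R)) reZ.
have gE A Y B : re (g (A, Y, B)) = (re (P A) + re (Q B)) / 2 + re (F Y).
  have -> : (A, Y, B) = (A, 0, 0) + (0, 0, B) + (0, Y, 0).
    by congr (_, _, _); rewrite /= ?addr0 ?add0r.
  by rewrite !(linearD g) !reD /P /Q /F /= !re2 mul1r; lra.
have P_le A t : numrange_le A t -> re (P A) <= t.
  move=> At; have : re (g (A, 0, 0)) <= (t + 0) / 2; last first.
    by rewrite addr0 /P/= re2; lra.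
  apply: gK; apply: (@ruan_cone_tau0 _ _ _ hp n x0 n_gt0 A 0 0 1 0 0 0).
  - by [].
  - by rewrite (mxsn0 hp).
  - by rewrite mulmx0 addr0.
  - by rewrite mulmx0 addr0; exact: numrange_le0.
  - rewrite bimulmx0 addr0.
    by apply/matrixP => i j; rewrite !mxE ffunE.
have Q_le B t : numrange_le B t -> re (Q B) <= t.
  move=> Bt; have : re (g (0, 0, B)) <= (0 + t) / 2; last first.
    by rewrite add0r /Q/= re2; lra.
  apply: gK; apply: (@ruan_cone_tau0 _ _ _ hp n x0 n_gt0 0 0 B 1 0 0 0).
  - by [].
  - by rewrite (mxsn0 hp).
  - by rewrite mulmx0 addr0; exact: numrange_le0.
  - by rewrite mulmx0 addr0.
  - rewrite bimulmx0 addr0.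
    by apply/matrixP => i j; rewrite !mxE ffunE.
pose unitE k l (x : E) : {ffun 'I_n * 'I_n -> E} :=
  [ffun kl => if kl == (k, l) then x else 0].
have unitE_lin k l : linear (unitE k l).
  move=> a x y; apply/ffunP => kl; rewrite !ffunE.
  by case: eqP => // _; rewrite scaler0 addr0.
pose M x := \matrix_(l, k) F (unitE k l x).
have M_lin : linear M.
  by move=> a x y; apply/matrixP => l k; rewrite !mxE unitE_lin linearP.
have diag1 : numrange_le (1%:M ^t* *m 1%:M : 'M[R[i]]_n) 1.
  by move=> v; rewrite trmx1 map_mx1 !mulmx1 mul1r.
have diagformE (L : {scalar 'M[R[i]]_n}) r c : @diagform (gram L) r c = re (L (c ^t* *m c)).
  by rewrite -gramE re_sum.
(* Y is expanded over matrix units, then F is applied and the sums exchanged. *)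
have mxformE r (x : 'M[E]_r) (b c : 'M_(r, n)) (Y : {ffun 'I_n * 'I_n -> E}) :
    bimulmx (c ^t*) x b = \matrix_(k, l) Y (k, l) -> mxform M x b c = F Y.
  move=> /matrixP xY.
  have -> : Y = \sum_k \sum_l \sum_i \sum_j ((c i k)^* * b j l) *: unitE k l (x i j).
    apply/ffunP => -[k l]; have := xY k l; rewrite !mxE => <-.
    rewrite sum_ffunE (bigD1 k)//= [X in _ + X]big1 ?addr0 => [|k' k'k]; last first.
      rewrite sum_ffunE big1// => l' _; rewrite sum_ffunE big1// => i _.
      rewrite sum_ffunE big1// => j _; rewrite !ffunE xpair_eqE eq_sym.
      by rewrite (negbTE k'k) scaler0.
    rewrite sum_ffunE (bigD1 l)//= [X in _ + X]big1 ?addr0 => [|l' l'l]; last first.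
      rewrite sum_ffunE big1// => i _.
      rewrite sum_ffunE big1// => j _; rewrite !ffunE xpair_eqE [l == l']eq_sym.
      by rewrite (negbTE l'l) andbF scaler0.
    rewrite sum_ffunE; apply: eq_bigr => i _.
    rewrite sum_ffunE; apply: eq_bigr => j _.
    by rewrite !ffunE eqxx !mxE.
  pose t i j k l := (c i k)^* * b j l * F (unitE k l (x i j)).
  transitivity (\sum_i \sum_j \sum_k \sum_l t i j k l).
    apply: eq_bigr => i _; apply: eq_bigr => j _.
    rewrite dotmxE mxE; apply: eq_bigr => k _.
    rewrite !mxE mulr_suml; apply: eq_bigr => l _.
    by rewrite !mxE /t; ring.
  transitivity (\sum_k \sum_l \sum_i \sum_j t i j k l).
    under [RHS]eq_bigr => k _ do rewrite exchange_big/=.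
    rewrite [RHS]exchange_big/=; apply: eq_bigr => i _.
    under [RHS]eq_bigr => k _ do rewrite exchange_big/=.
    by rewrite [RHS]exchange_big.
  rewrite linear_sum; apply: eq_bigr => k _.
  rewrite linear_sum; apply: eq_bigr => l _.
  rewrite linear_sum; apply: eq_bigr => i _.
  rewrite linear_sum; apply: eq_bigr => j _.
  by rewrite linearZ.
exists M, (gram P), (gram Q); split.
- exact: M_lin.
- by split; apply: gram_psd => A; [exact: P_le|exact: Q_le].
- by rewrite !diagformE; split; [exact: P_le|exact: Q_le].
- move=> r x b c r0 x1; rewrite !diagformE.
  pose Y : {ffun 'I_n * 'I_n -> E} := [ffun kl => bimulmx (c ^t*) x b kl.1 kl.2].
  have YE : bimulmx (c ^t*) x b = \matrix_(k, l) Y (k, l).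
    by apply/matrixP => k l; rewrite [RHS]mxE ffunE.
  rewrite (mxformE _ _ _ _ _ YE).
  have : re (g (- (c ^t* *m c), Y, - (b ^t* *m b))) <= (0 + 0) / 2.
    apply/gK/(@ruan_cone_tau0 _ _ _ hp n x0 n_gt0 _ _ _ r c b (- x) 0 0 r0).
    - by rewrite (mxsnN hp).
    - by rewrite addNr; exact: numrange_le0.
    - by rewrite addNr; exact: numrange_le0.
    - by rewrite bimulmxN YE subrr.
  by rewrite gE (linearN P) (linearN Q) !reN; lra.
pose Y : {ffun 'I_n * 'I_n -> E} := [ffun kl => x0 kl.1 kl.2].
have YE : x0 = \matrix_(k, l) Y (k, l).
  by apply/matrixP => k l; rewrite [RHS]mxE ffunE.
have bimul1 : bimulmx (1%:M ^t*) x0 1%:M = x0.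
  rewrite trmx1 map_mx1; apply/matrixP => i j; rewrite mxE (bigD1 i)//=.
  rewrite [X in _ + X]big1 ?addr0 => [|k ki]; last first.
    by rewrite big1// => l _; rewrite !mxE eq_sym (negbTE ki) mul0r scale0r.
  rewrite (bigD1 j)//= big1 => [|l lj]; first by rewrite !mxE !eqxx mulr1 scale1r addr0.
  by rewrite !mxE (negbTE lj) mulr0 scale0r.
rewrite (mxformE _ _ _ _ Y); last by rewrite bimul1.
have : re (g (0, - Y, 0)) <= - p x0; last first.
  by rewrite gE (linear0 P) (linear0 Q) (linearN F) reN/=; lra.
apply: gK; exists 1%N, 0, 0, 0, 1, 0, 0; split.
- by [].
- exact: ler01.
- by rewrite (mxsn0 hp).
- by rewrite /= !mulmx0 addr0; split; exact: numrange_le0.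
- rewrite /= bimulmx0 rmorph1 zmulmx1 addr0.
  set y := (X in p X); have -> : y = 0.
    by rewrite /y YE; apply/matrixP => i j; rewrite !mxE ffunE addr0 addNr.
  by rewrite (mxsn0 hp)// mul1r mul0r !add0r.
Qed.

End dominating_forms.

(** * Completely contractive maps into matrices *)

Section complete_contraction.
Variables (R : realType) (E : lmodType R[i]) (p : forall n, 'M[E]_n -> R).
Hypothesis hp : matrix_seminorm p.
Local Open Scope sesquilinear_scope.
Local Notation re := (@complex.Re R).
Local Notation "c %:C" := (real_complex R c).
Local Notation zmulmx c := (map_mx ( *:%R c)).

(** The matrix (phi (x i j)) acting on a family v of vectors. Matrices multiply row
vectors on the right, but the indices of x act as on columns, as in the
amplification of a map to L(H^r). *)
Definition mxapp n (phi : E -> 'M[R[i]]_n) r (x : 'M[E]_r) (v : 'I_r -> 'rV[R[i]]_n)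
    (i : 'I_r) : 'rV[R[i]]_n := \sum_j v j *m phi (x i j).

Definition complete_contraction n (phi : E -> 'M[R[i]]_n) : Prop :=
  linear phi /\ forall r (x : 'M[E]_r) (v : 'I_r -> 'rV[R[i]]_n), (0 < r)%N ->
    \sum_i sqn (mxapp phi x v i) <= p x ^+ 2 * \sum_j sqn (v j).

Section forms.
Variables (n : nat) (M : E -> 'M[R[i]]_n).
Hypothesis M_lin : linear M.

Lemma mxform_app r (x : 'M[E]_r) (b c : 'M_(r, n)) :
  mxform M x b c = \sum_i dotmx (mxapp M x (fun j => row j b) i) (row i c).
Proof. by apply: eq_bigr => i _; rewrite dotmx_suml. Qed.

Lemma mxformBl r (x : 'M[E]_r) (b b' c : 'M_(r, n)) :
  mxform M x (b - b') c = mxform M x b c - mxform M x b' c.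
Proof.
rewrite /mxform -sumrB; apply: eq_bigr => i _; rewrite -sumrB.
apply: eq_bigr => j _.
by rewrite -dotmxNl -dotmxDl linearB/= mulmxBl.
Qed.

Lemma mxformBr r (x : 'M[E]_r) (b c c' : 'M_(r, n)) :
  mxform M x b (c - c') = mxform M x b c - mxform M x b c'.
Proof.
rewrite /mxform -sumrB; apply: eq_bigr => i _; rewrite -sumrB.
apply: eq_bigr => j _; rewrite linearB/=; exact: linearBr.
Qed.

Lemma mxformZ r (x : 'M[E]_r) (b c : 'M_(r, n)) (s t u : R) :
  mxform M (zmulmx s%:C x) (t%:C *: b) (u%:C *: c) = (s * t * u)%:C * mxform M x b c.
Proof.
pose f := linear_of M_lin.
rewrite /mxform mulr_sumr; apply: eq_bigr => i _; rewrite mulr_sumr.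
apply: eq_bigr => j _; rewrite mxE.
have -> : M (s%:C *: x i j) = s%:C *: M (x i j) by exact: (linearZ_LR f).
have rowZ a (d : 'M_(r, n)) k : row k (a *: d) = a *: row k d.
  by apply/rowP => l; rewrite !mxE.
rewrite !rowZ -scalemxAr -scalemxAl scalerA dotmxZl.
by rewrite dotmxZr conj_realC mulrA !rmorphM.
Qed.

End forms.

Lemma diagform_factor n r (T : 'M[R[i]]_n) (c : 'M_(r, n)) :
  diagform (T *m T ^t*) c = \sum_i sqn (row i (c *m T)).
Proof.
by apply: eq_bigr => i _; rewrite mulmxA dotmx_adjr trmxCK row_mul.
Qed.

Lemma bounded_multiples_eq0 (a K : R) : (forall s, s * a <= K) -> a = 0.
Proof.
move=> saK; apply/eqP/negP => /negP a0.
by have := saK ((K + 1) / a); rewrite divfK// gerDl ler10.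
Qed.

(** If q > 0, take s to be the inverse of q. If q = 0, arbitrarily large s are
allowed, so that a = 0. *)
Lemma le_sqrM_of_scaled (a b q : R) : 0 <= a -> 0 <= b -> 0 <= q ->
  (forall s, 0 <= s -> s * q <= 1 -> s ^+ 2 * a <= b) -> a <= q ^+ 2 * b.
Proof.
move=> a0 b0 + sab; rewrite le_eqVlt => /predU1P[q0|q_gt0]; last first.
  rewrite -ler_pdivrMl ?exprn_gt0// -exprVn.
  by apply: sab; [rewrite invr_ge0 ltW|rewrite mulVf ?lt0r_neq0].
rewrite -q0 expr0n mul0r leNgt; apply/negP => a_gt0.
have := sab (Num.sqrt ((b + 1) / a)) (sqrtr_ge0 _).
rewrite -q0 mulr0 ler01 => /(_ isT).
rewrite sqr_sqrtr ?divfK ?gt_eqF ?divr_ge0 ?addr_ge0//.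
by rewrite gerDl ler10.
Qed.

(** With T and S the square roots of the Gram matrices of P and Q, and W and Z
their pseudo-inverses, phi x = Z (M x) W^* satisfies
  Re <phi(x) v, u> <= (|u|^2 + |v|^2) / 2  whenever p x <= 1.
Taking u = phi(x) v gives |phi(x) v| <= |v|. For the lower bound, take the rows of
S and T as v and u: they have norm at most 1, and the form is p x0 or more
there. *)
Theorem norming_complete_contraction n (x0 : 'M[E]_n) : (0 < n)%N ->
  exists2 phi : E -> 'M[R[i]]_n, complete_contraction phi &
  exists2 v : 'I_n -> 'rV[R[i]]_n, \sum_j sqn (v j) <= 1 &
    p x0 ^+ 2 <= \sum_i sqn (mxapp phi x0 v i).
Proof.
move=> n0.
have [M [GP [GQ [M_lin [GP_psd GQ_psd] [trP trQ] M_le M_x0]]]] :=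
  dominating_forms hp x0 n0.
have [T [W [TG TW WT]]] := psd_factor GP_psd.
have [S [Z [SG SZ ZS]]] := psd_factor GQ_psd.
rewrite -{}TG -{}SG in trP trQ M_le; clear GP_psd GQ_psd GP GQ.
rewrite !diagform_factor !mul1mx in trP trQ.
have M_le_scale r (x : 'M[E]_r) (b c : 'M_(r, n)) (s u w : R) :
    (0 < r)%N -> 0 <= s -> s * p x <= 1 ->
    \sum_i sqn (row i (c *m T)) <= u -> \sum_i sqn (row i (b *m S)) <= w ->
    s * re (mxform M x b c) <= (u + w) / 2.
  move=> r0 s0 sx cu bw.
  have := M_le r (zmulmx s%:C x) b c r0; rewrite (mxsnZ_real hp)// => /(_ sx).
  have := mxformZ M_lin x b c s 1 1; rewrite rmorph1 !scale1r !mulr1 => ->.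
  rewrite reZ => /le_trans; apply; rewrite ler_wpM2r ?invr_ge0//.
  by apply: lerD; rewrite diagform_factor.
have sqn_null r (d : 'M[R[i]]_(r, n)) D : d *m D = 0 ->
    \sum_i sqn (row i (d *m D)) <= 0.
  by move=> ->; rewrite big1// => i _; rewrite row0 sqn0.
have p_scale r (x : 'M[E]_r) : (0 < r)%N -> exists2 a, 0 < a & a * p x <= 1.
  move=> r0; have px := mxsn_ge0 hp x r0; exists (p x + 1)^-1.
    by rewrite invr_gt0 ltr_wpDl.
  by rewrite mulrC ler_pdivrMr ?ltr_wpDl// mul1r lerDl.
(* The form vanishes on the kernels of T and S, by homogeneity: so nothing is lost
   in passing through the pseudo-inverses. *)
have nullr r (x : 'M[E]_r) (b c : 'M_(r, n)) : (0 < r)%N -> c *m T = 0 ->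
    re (mxform M x b c) = 0.
  move=> r0 cT; have [a a0 ax] := p_scale r x r0.
  apply/(mulfI (lt0r_neq0 a0)); rewrite mulr0.
  apply: (@bounded_multiples_eq0 _ ((0 + \sum_i sqn (row i (b *m S))) / 2)) => s.
  have e : re (mxform M x b (s%:C *: c)) = s * re (mxform M x b c).
    rewrite -reZ; have := mxformZ M_lin x b c 1 1 s.
    by rewrite rmorph1 zmulmx1 scale1r !mul1r => ->.
  rewrite mulrCA -e; apply: M_le_scale => //; first exact: ltW.
  by apply: sqn_null; rewrite -scalemxAl cT scaler0.
have nulll r (x : 'M[E]_r) (b c : 'M_(r, n)) : (0 < r)%N -> b *m S = 0 ->
    re (mxform M x b c) = 0.
  move=> r0 bS; have [a a0 ax] := p_scale r x r0.
  apply/(mulfI (lt0r_neq0 a0)); rewrite mulr0.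
  apply: (@bounded_multiples_eq0 _ ((\sum_i sqn (row i (c *m T)) + 0) / 2)) => s.
  have e : re (mxform M x (s%:C *: b) c) = s * re (mxform M x b c).
    rewrite -reZ; have := mxformZ M_lin x b c 1 s 1.
    by rewrite rmorph1 zmulmx1 scale1r mul1r mulr1 => ->.
  rewrite mulrCA -e; apply: M_le_scale => //; first exact: ltW.
  by apply: sqn_null; rewrite -scalemxAl bS scaler0.
pose phi x := Z *m M x *m W ^t*.
have phi_lin : linear phi.
  by move=> a x y; rewrite /phi M_lin mulmxDr mulmxDl -scalemxAr -scalemxAl.
have mxform_phi r (x : 'M[E]_r) (b c : 'M_(r, n)) :
    re (mxform M x (b *m Z) (c *m W)) =
    \sum_i re (dotmx (mxapp phi x (fun j => row j b) i) (row i c)).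
  rewrite -re_sum -mxform_app; apply: (congr1 re).
  apply: eq_bigr => i _; apply: eq_bigr => j _.
  by rewrite !row_mul /phi !mulmxA [RHS]dotmx_adjr trmxCK.
clearbody phi.
exists phi.
  split=> // r x v r0; apply: le_sqrM_of_scaled.
  - by apply: sumr_ge0 => i _; exact: sqn_ge0.
  - by apply: sumr_ge0 => i _; exact: sqn_ge0.
  - exact: (mxsn_ge0 hp).
  move=> s s0 sx; set A := (X in _ * X <= _); set B := (X in _ <= X).
  pose b := \matrix_(j < r) v j; pose c := \matrix_(i < r) (s%:C *: mxapp phi x v i).
  have rb j : row j b = v j by rewrite rowK.
  have rc i : row i c = s%:C *: mxapp phi x v i by rewrite rowK.
  have formE : re (mxform M x (b *m Z) (c *m W)) = s * A.
    rewrite mxform_phi (_ : (fun j => row j b) = v); last exact/funext.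
    by rewrite mulr_sumr; apply: eq_bigr => i _; rewrite rc re_dotmxZr.
  have cWT : \sum_i sqn (row i (c *m W *m T)) <= s ^+ 2 * A.
    rewrite mulr_sumr; apply: ler_sum => i _; rewrite -sqnZ -rc 2!row_mul.
    exact/le_re/WT.
  have bZS : \sum_i sqn (row i (b *m Z *m S)) <= B.
    by apply: ler_sum => j _; rewrite -(rb j) 2!row_mul; exact/le_re/ZS.
  have := M_le_scale r x _ _ s _ _ r0 s0 sx cWT bZS.
  rewrite formE mulrA -expr2; clearbody A B; clear; lra.
exists (fun j => row j S) => //.
set A := (X in _ <= X).
have formE : re (mxform M x0 (S *m Z) (T *m W)) = re (mxform M x0 1%:M 1%:M).
  transitivity (re (mxform M x0 (S *m Z) 1%:M)).
    apply/eqP; rewrite -subr_eq0 -reB -mxformBr; apply/eqP/nullr => //.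
    by rewrite mulmxBl mul1mx TW subrr.
  apply/eqP; rewrite -subr_eq0 -reB -mxformBl; apply/eqP/nulll => //.
  by rewrite mulmxBl mul1mx SZ subrr.
have polar : 2 * p x0 * re (mxform M x0 1%:M 1%:M) <=
    A + p x0 ^+ 2 * \sum_i sqn (row i T).
  rewrite -formE mxform_phi !mulr_sumr -big_split/=.
  by apply: ler_sum => i _; exact: sqn_polar.
have px := mxsn_ge0 hp x0 n0.
move: M_x0 trP polar px; move: (re _) (\sum_i _) (p x0) => m t q; clearbody A; clear.
nra.
Qed.

End complete_contraction.

(** * Unconditional sums *)

#[local] Existing Instance totally_filter.

Lemma cvg_le_bound (R : realType) (T : Type) (F : set_system T)
    {FF : ProperFilter F} (f : T -> R) (l M : R) :
  f x @[x --> F] --> l -> (\forall x \near F, f x <= M) -> l <= M.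
Proof.
move=> fl fM; rewrite -(cvg_lim (@Rhausdorff R) fl); apply: limr_le => //.
by apply/cvg_ex; exists l.
Qed.

Lemma cvg_sumr (R : realType) (T : Type) (F : set_system T) (I : Type) (r : seq I)
    (f : I -> T -> R) (l : I -> R) : Filter F ->
  (forall i, f i x @[x --> F] --> l i) ->
  \sum_(i <- r) f i x @[x --> F] --> \sum_(i <- r) l i.
Proof.
move=> FF fl; elim: r => [|i r IHr].
  rewrite big_nil; under eq_fun do rewrite big_nil; exact: cvg_cst.
rewrite big_cons; under eq_fun do rewrite big_cons; exact: cvgD.
Qed.

Section unconditional_sums.
Variables (R : realType) (S : choiceType).
Local Notation re := (@complex.Re R).
Local Notation im := (@complex.Im R).

Definition fsum (V : nmodType) (a : S -> V) (A : {fset S}) : V := \sum_(s <- A) a s.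

Lemma fsum_le (a : S -> R) (A B : {fset S}) : (forall s, 0 <= a s) ->
  (A `<=` B)%fset -> fsum a A <= fsum a B.
Proof.
move=> a0 AB; rewrite /fsum (big_fsetID _ (mem A) B)/=.
rewrite (_ : [fset x | x in B & x \in A]%fset = A); last first.
  apply/fsetP => s; rewrite !inE/= andbC.
  by case: (boolP (s \in A)) => //= /(fsubsetP AB) ->.
by rewrite lerDl sumr_ge0.
Qed.

Lemma fsum_cvg (a : S -> R) (M : R) : (forall s, 0 <= a s) ->
  (forall A, fsum a A <= M) -> cvg (fsum a @ totally).
Proof.
move=> a0 aM; apply/cvg_ex; exists (sup (range (fsum a))).
have supa : has_sup (range (fsum a)).
  by split; [exists (fsum a fset0), fset0|exists M => _ [A _ <-]].
apply/cvgrPdist_le => e e0.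
have [_ [A _ <-] Ae] := sup_adherent e0 supa.
exists A => //= B AB; have aB : fsum a B <= sup (range (fsum a)).
  by apply: sup_upper_bound => //; exists B.
rewrite ger0_norm ?subr_ge0// lerBlDl addrC -lerBlDl.
by rewrite (le_trans (ltW _) (fsum_le a0 AB))// lerBlDr addrC -lerBlDr.
Qed.

Lemma fsum_lim_ge (a : S -> R) (A : {fset S}) : (forall s, 0 <= a s) ->
  cvg (fsum a @ totally) -> fsum a A <= lim (fsum a @ totally).
Proof.
move=> a0 acvg; apply: limr_ge => //; exists A => //= B; exact: fsum_le.
Qed.

Lemma fsum_lim_le (a : S -> R) (M : R) : cvg (fsum a @ totally) ->
  (forall A, fsum a A <= M) -> lim (fsum a @ totally) <= M.
Proof. by move=> acvg aM; apply: limr_le => //; exists fset0. Qed.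

Definition has_fsum (a : S -> R) (l : R) : Prop := fsum a @ totally --> l.

Lemma has_fsum_lim a l : has_fsum a l -> lim (fsum a @ totally) = l.
Proof. exact: cvg_lim. Qed.

Lemma has_fsum_lin (b c : R) (u v : S -> R) l m : has_fsum u l -> has_fsum v m ->
  has_fsum (fun s => b * u s + c * v s) (b * l + c * m).
Proof.
move=> ul vm; rewrite /has_fsum.
rewrite (_ : fsum _ = (fun A => b * fsum u A + c * fsum v A)).
  by apply: cvgD; apply: cvgMr.
by apply/funext => A; rewrite /fsum big_split/= !mulr_sumr.
Qed.

(** Complex sums are handled coordinatewise, so that only real limits are taken. *)
Definition has_csum (z : S -> R[i]) (l : R[i]) : Prop :=
  has_fsum (re \o z) (re l) /\ has_fsum (im \o z) (im l).

Definition csum (z : S -> R[i]) : R[i] :=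
  Complex (lim (fsum (re \o z) @ totally)) (lim (fsum (im \o z) @ totally)).

Lemma has_csum_unique z l : has_csum z l -> csum z = l.
Proof.
by case: l => a b [/has_fsum_lim az /has_fsum_lim bz]; rewrite /csum az bz.
Qed.

Lemma has_csum_lin (a : R[i]) z w l m : has_csum z l -> has_csum w m ->
  has_csum (fun s => a * z s + w s) (a * l + m).
Proof.
case: a => a b [zr zi] [wr wi]; split.
- have := @has_fsum_lin 1 1 _ _ _ _ (@has_fsum_lin a (- b) _ _ _ _ zr zi) wr.
  rewrite !mul1r; congr (has_fsum _ _); last first.
    by case: l m {zr zi wr wi} => ? ? [? ?]/=; ring.
  by apply/funext => s /=; case: (z s) (w s) => ? ? [? ?]/=; ring.
- have := @has_fsum_lin 1 1 _ _ _ _ (@has_fsum_lin a b _ _ _ _ zi zr) wi.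
  rewrite !mul1r; congr (has_fsum _ _); last first.
    by case: l m {zr zi wr wi} => ? ? [? ?]/=; ring.
  by apply/funext => s /=; case: (z s) (w s) => ? ? [? ?]/=; ring.
Qed.

Lemma has_csum_conj z l : has_csum z l ->
  has_csum (fun s => Num.conj (z s)) (Num.conj l).
Proof.
move=> [zr zi]; split.
  have := @has_fsum_lin 1 0 _ _ _ _ zr zi; congr (has_fsum _ _); last first.
    by case: l {zr zi} => ? ? /=; ring.
  by apply/funext => s /=; case: (z s) => ? ? /=; ring.
have := @has_fsum_lin (-1) 0 _ _ _ _ zi zr; congr (has_fsum _ _); last first.
  by case: l {zr zi} => ? ? /=; ring.
by apply/funext => s /=; case: (z s) => ? ? /=; ring.
Qed.

End unconditional_sums.

(** * The Hilbert sum of a family of finite-dimensional spaces *)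

Section hilbert_sum.
Variables (R : realType) (S : choiceType) (d : S -> nat).
Local Notation re := (@complex.Re R).
Local Notation im := (@complex.Im R).
Local Notation "c %:C" := (real_complex R c).
Local Notation fam := (lmodProd (fun s => 'rV[R[i]]_(d s))).
Definition square_summable : {pred fam} := fun f =>
  `[< exists M : R, forall A, fsum (fun s => sqn (f s)) A <= M >].

Lemma square_summable_submod : submod_closed square_summable.
Proof.
split=> [|a f g /asboolP[M fM] /asboolP[N gN]]; apply/asboolP.
  by exists 0 => A; rewrite /fsum big1// => s _; exact: sqn0.
exists (2 * (re (`|a| ^+ 2) * M) + 2 * N) => A.
have a2 : 0 <= re (`|a| ^+ 2) by apply: re_ge0; rewrite exprn_ge0.
apply: (@le_trans _ _ (2 * (re (`|a| ^+ 2) * fsum (fun s => sqn (f s)) A) +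
    2 * fsum (fun s => sqn (g s)) A)).
  rewrite /fsum !mulr_sumr -big_split/=; apply: ler_sum => s _.
  by rewrite -sqnZ_complex; exact: sqnD_le.
by apply: lerD; [exact/ler_wpM2l/(ler_wpM2l a2)/fM|exact/ler_wpM2l/gN].
Qed.

HB.instance Definition _ := GRing.isSubmodClosed.Build R[i] fam square_summable
  square_summable_submod.

Record hsum := HSum { hsum_fun : fam ; hsumP : hsum_fun \in square_summable }.

HB.instance Definition _ := [isSub for hsum_fun].
HB.instance Definition _ := [Choice of hsum by <:].
HB.instance Definition _ := [SubChoice_isSubLmodule of hsum by <:].

Local Notation blk f s := (hsum_fun f s).

Lemma hsum_sqn_cvg (f : hsum) : cvg (fsum (fun s => sqn (blk f s)) @ totally).
Proof.
have /asboolP[M fM] := hsumP f; apply: fsum_cvg fM => s; exact: sqn_ge0.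
Qed.

Definition hdot (f g : hsum) : R[i] := csum (fun s => dotmx (blk f s) (blk g s)).

Definition hsq (f : hsum) : R := lim (fsum (fun s => sqn (blk f s)) @ totally).

Lemma has_fsum_hsq (f : hsum) : has_fsum (fun s => sqn (blk f s)) (hsq f).
Proof. exact: hsum_sqn_cvg. Qed.

Lemma fsum_le_hsq (f : hsum) A : fsum (fun s => sqn (blk f s)) A <= hsq f.
Proof. by apply: fsum_lim_ge; [move=> s; exact: sqn_ge0|exact: hsum_sqn_cvg]. Qed.

Lemma hsq_le (f : hsum) M :
  (forall A, fsum (fun s => sqn (blk f s)) A <= M) -> hsq f <= M.
Proof. exact/fsum_lim_le/hsum_sqn_cvg. Qed.

Lemma sqn_le_hsq (f : hsum) s : sqn (blk f s) <= hsq f.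
Proof.
by apply: le_trans (fsum_le_hsq f [fset s]%fset); rewrite /fsum big_seq_fset1.
Qed.

(** By polarization, the sum is half of |f + g|^2 - |f|^2 - |g|^2. *)
Lemma has_fsum_re (f g : hsum) :
  exists l, has_fsum (fun s => re (dotmx (blk f s) (blk g s))) l.
Proof.
have h := @has_fsum_lin _ _ (2^-1) (- 2^-1) _ _ _ _ (@has_fsum_hsq (f + g))
  (@has_fsum_lin _ _ 1 1 _ _ _ _ (@has_fsum_hsq f) (@has_fsum_hsq g)).
eexists; move: h; congr (has_fsum _ _); apply/funext => s.
rewrite [sqn (blk (f + g) s)](sqnD (blk f s) (blk g s)).
by move: (sqn _) (sqn _) (re _) => a b c; lra.
Qed.

(** The imaginary part of <f, g> is the real part of <f, i g>. *)
Lemma has_csum_hdot (f g : hsum) :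
  has_csum (fun s => dotmx (blk f s) (blk g s)) (hdot f g).
Proof.
have [a fa] := has_fsum_re f g; have [b fb] := has_fsum_re f (Complex 0 1 *: g).
suff h : has_csum (fun s => dotmx (blk f s) (blk g s)) (Complex a b).
  by rewrite /hdot (has_csum_unique h).
split=> //=; move: fb; congr (has_fsum _ _); apply/funext => s.
rewrite [blk (Complex 0 1 *: g) s](_ : _ = Complex 0 1 *: blk g s)// dotmxZr.
by move=> /=; case: (dotmx (blk f s) (blk g s)) => x y /=; ring.
Qed.

Lemma hdot_linear_l g : linear_for *%R (hdot ^~ g).
Proof.
move=> a f f' /=; apply: has_csum_unique.
have := has_csum_lin a (has_csum_hdot f g) (has_csum_hdot f' g).
congr (has_csum _ _); apply/funext => s.
by rewrite -dotmxZl -dotmxDl.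
Qed.

Lemma hdotC f g : hdot f g = Num.conj (hdot g f).
Proof.
apply: has_csum_unique; have := has_csum_conj (has_csum_hdot g f).
by congr (has_csum _ _); apply/funext => s; rewrite [RHS]dotmxC.
Qed.

Lemma hdot_linear_r f : linear_for (Num.conj \; *%R) (hdot f).
Proof.
move=> a g g'; rewrite (hdotC f (a *: g + g')) hdot_linear_l rmorphD rmorphM.
by rewrite [in RHS](hdotC f g) [in RHS](hdotC f g').
Qed.

HB.instance Definition _ := @bilinear_isBilinear.Build R[i] hsum hsum R[i] *%R
  (Num.conj \; *%R) hdot (hdot_linear_l, hdot_linear_r).

Lemma hdot_hermitian f g : hdot f g = (-1) ^+ false * Num.conj (hdot g f).
Proof. by rewrite expr0 mul1r -hdotC. Qed.

HB.instance Definition _ := @isHermitianSesquilinear.Build R[i] hsum false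
  Num.conj hdot hdot_hermitian.

Lemma hdot_hsq f : hdot f f = (hsq f)%:C.
Proof.
apply: has_csum_unique; split; first exact: has_fsum_hsq.
rewrite (_ : im \o _ = fun=> 0); last by apply/funext => s /=; rewrite sqnE.
have := @has_fsum_lin _ _ 0 0 _ _ _ _ (@has_fsum_hsq f) (@has_fsum_hsq f).
rewrite !mul0r addr0; congr (has_fsum _ _); apply/funext => s.
by rewrite !mul0r addr0.
Qed.

Lemma hsq_ge0 f : 0 <= hsq f.
Proof. by apply: le_trans (fsum_le_hsq f fset0); rewrite /fsum big_seq_fset0. Qed.

Lemma hdot_gt0 f : f != 0 -> 0 < hdot f f.
Proof.
move=> f0; rewrite hdot_hsq ltcR lt_neqAle andbC.
rewrite hsq_ge0 eq_sym; apply: contra_neq f0 => f0.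
apply/val_inj/functional_extensionality_dep => s /=; apply/eqP.
rewrite -(dnorm_eq0 (@dotmx R[i] (d s))) -[X in X == 0]/(dotmx (blk f s) (blk f s)).
rewrite sqnE -(rmorph0 (real_complex R)) (inj_eq (@complexI R)).
by rewrite eq_le sqn_ge0 andbT -f0 sqn_le_hsq.
Qed.

HB.instance Definition _ := @isDotProduct.Build R[i] hsum hdot hdot_gt0.

Definition hnorm (f : hsum) : R[i] := (Num.sqrt (hsq f))%:C.

Lemma hnorm_sqrt f : hnorm f = sqrtC (hdot f f).
Proof.
rewrite hdot_hsq -[in RHS](sqr_sqrtr (hsq_ge0 f)) rmorphXn sqrCK//.
by rewrite lecR sqrtr_ge0.
Qed.

Lemma hnormD f g : hnorm (f + g) <= hnorm f + hnorm g.
Proof. by rewrite !hnorm_sqrt; exact: sqrt_dnorm_triangle. Qed.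

Lemma hnormZ a f : hnorm (a *: f) = `|a| * hnorm f.
Proof.
rewrite !hnorm_sqrt [hdot (a *: f) _](dnormZ hdot a f) rootCMl ?exprn_ge0//.
by rewrite sqrCK.
Qed.

Lemma hnorm0_eq0 f : hnorm f = 0 -> f = 0.
Proof.
by rewrite hnorm_sqrt => /eqP; rewrite sqrt_dnorm_eq0 => /eqP.
Qed.

HB.instance Definition _ := @Lmodule_isNormed.Build R[i] hsum hnorm hnormD hnormZ hnorm0_eq0.

Lemma hsum_normE f : `|f| = hnorm f.
Proof. by []. Qed.

Lemma hsum_inner_norm (f : hsum) : hdot f f = `|f| ^+ 2.
Proof. by rewrite hsum_normE hnorm_sqrt sqrtCK. Qed.

Lemma hsum_ball (f g : hsum) (e : R) : 0 < e ->
  ball f e%:C g <-> hsq (f - g) < e ^+ 2.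
Proof.
move=> e0; rewrite -ball_normE /ball_/= hsum_normE ltcR.
by rewrite -[X in _ < X]ger0_norm ?ltW// -sqrtr_sqr ltr_sqrt ?exprn_gt0.
Qed.

(** A Cauchy filter converges in each coordinate, to l say. The bound on |g - h|^2
for g and h in a small set of the filter passes to the limit in h on each finite
partial sum, so that g - l is square summable, and small. *)
Lemma hsum_complete (F : set_system hsum) : ProperFilter F -> cauchy F -> cvg F.
Proof.
move=> FF /cauchy_ballP Fc.
have small (e : R) : 0 < e -> exists2 B, F B &
    forall g h, B g -> B h -> hsq (g - h) < e ^+ 2.
  move=> e0; have e0' : 0 < e%:C by rewrite ltcR.
  have [[P Q] [FP FQ] PQ] := Fc _ e0'.
  exists (P `&` Q); first exact: filterI.
  by move=> g h [Pg _] [_ Qh]; apply/(hsum_ball _ _ e0); exact: (PQ (g, h)).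
have coord_cvg (c : hsum -> R) : (forall g h, (c g - c h) ^+ 2 <= hsq (g - h)) ->
    cvg (c h @[h --> F]).
  move=> c_le; apply: cauchy_cvg; apply/cauchyP => e e0.
  have [B FB Be] := small e e0; have [g Bg] := filter_ex FB.
  exists (c g); suff: F [set h | ball (c g) e (c h)] by [].
  apply: filterS FB => h Bh.
  rewrite /= -ball_normE /= -(ltr_pXn2r (n := 2))// ?nnegrE// ?ltW//.
  by rewrite real_normK ?num_real//; apply: le_lt_trans (c_le g h) (Be _ _ Bg Bh).
have re_cvg s k : cvg (re (blk h s 0 k) @[h --> F]).
  apply: coord_cvg => g h; apply: le_trans (sqn_le_hsq _ s).
  by have [+ _] := sqn_coord_le (blk (g - h) s) k; rewrite !mxE reB.
have im_cvg s k : cvg (im (blk h s 0 k) @[h --> F]).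
  apply: coord_cvg => g h; apply: le_trans (sqn_le_hsq _ s).
  have [_] := sqn_coord_le (blk (g - h) s) k; rewrite !mxE.
  by case: (blk g s 0 k) (blk h s 0 k) => a b [a' b'].
pose l : fam := fun s => \row_k
  Complex (lim (re (blk h s 0 k) @[h --> F])) (lim (im (blk h s 0 k) @[h --> F])).
have sqn_cvg (g : hsum) s : sqn (blk g s - blk h s) @[h --> F] --> sqn (blk g s - l s).
  rewrite sqn_coord; under eq_fun do rewrite sqn_coord.
  have sqr_cvg (u : hsum -> R) a b : a - u h @[h --> F] --> a - b ->
      (a - u h) ^+ 2 @[h --> F] --> (a - b) ^+ 2.
    by move=> uab; rewrite expr2; under eq_fun do rewrite expr2; exact: cvgM.
  have imB (z w : R[i]) : im (z - w) = im z - im w by case: z w => [? ?] [? ?].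
  apply: cvg_sumr => k.
  rewrite !mxE reB imB /=; under eq_fun do rewrite !mxE reB imB.
  by apply: cvgD; apply: sqr_cvg; apply: cvgB; [exact: cvg_cst|exact: re_cvg|
    exact: cvg_cst|exact: im_cvg].
have tail e : 0 < e -> exists2 B, F B &
    forall g, B g -> forall A, fsum (fun s => sqn (blk g s - l s)) A <= e ^+ 2.
  move=> e0; have [B FB Be] := small e e0; exists B => // g Bg A.
  have cv : fsum (fun s => sqn (blk g s - blk h s)) A @[h --> F] -->
      fsum (fun s => sqn (blk g s - l s)) A by exact: cvg_sumr.
  apply: (cvg_le_bound cv); apply: filterS FB => h Bh.
  apply: le_trans (ltW (Be _ _ Bg Bh)).
  exact: (fsum_le_hsq (g - h) A).
have l_ss : l \in square_summable.
  have [B FB Be] := tail 1 ltr01; have [g Bg] := filter_ex FB.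
  have gl : (hsum_fun g - l : fam) \in square_summable.
    by apply/asboolP; exists (1 ^+ 2); exact: Be Bg.
  have -> : l = hsum_fun g - (hsum_fun g - l) by rewrite subKr.
  exact: (rpredB (hsumP g) gl).
pose lh := HSum l_ss.
apply/cvg_ex; exists lh; apply/(@cvg_ballP _ _ _ F _ id) => eps eps0.
have e0 : 0 < re eps by move: eps0; rewrite ltcE => /andP[].
have epsE : eps = (re eps)%:C by rewrite reK_ge0// ltW.
have e20 : 0 < re eps / 2 by rewrite divr_gt0.
have [B FB Be] := tail _ e20; apply: filterS FB => g Bg.
rewrite epsE; apply/ball_sym/(hsum_ball _ _ e0).
apply: (@le_lt_trans _ _ ((re eps / 2) ^+ 2)).
  by apply: hsq_le => A; exact: Be.
by rewrite ltr_pXn2r ?nnegrE ?ltW//; move: e0; lra.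
Qed.

HB.instance Definition _ := Uniform_isComplete.Build hsum hsum_complete.
HB.instance Definition _ := CompleteNormedModule_isHilbert.Build R hsum hsum_inner_norm.

End hilbert_sum.

(** * The universal representation *)

Section hilbert_sum_injections.
Variables (R : realType) (S : choiceType) (d : S -> nat).
Local Notation H := (@hsum R S d).

Definition block (s : S) (f : H) : 'rV[R[i]]_(d s) := hsum_fun f s.

Lemma hsum_ext (f g : H) : (forall s, block s f = block s g) -> f = g.
Proof. by move=> fg; apply/val_inj/functional_extensionality_dep. Qed.

Lemma block_sum I (r : seq I) (F : I -> H) s :
  block s (\sum_(j <- r) F j) = \sum_(j <- r) block s (F j).
Proof. by apply: (big_morph (block s)). Qed.

Definition single s (u : 'rV[R[i]]_(d s)) : lmodProd (fun t => 'rV[R[i]]_(d t)) :=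
  @eqtype.dfwith S (fun t => 'rV[R[i]]_(d t)) (fun=> 0) s u.

Lemma fsum_single s (u : 'rV[R[i]]_(d s)) A :
  fsum (fun t => sqn (single u t)) A <= sqn u.
Proof.
rewrite /fsum /single; have [sA|sA] := boolP (s \in A).
  rewrite (big_fsetD1 s)//= dfwith_in big1_fset ?addr0// => t.
  by rewrite !inE => /andP[ts _] _; rewrite dfwith_out ?sqn0// eq_sym.
rewrite big1_fset ?sqn_ge0// => t tA _; rewrite dfwith_out ?sqn0//.
by apply: contraNneq sA => ->.
Qed.

Lemma single_square_summable s (u : 'rV[R[i]]_(d s)) :
  single u \in @square_summable R S d.
Proof. by apply/asboolP; exists (sqn u) => A; exact: fsum_single. Qed.

Definition hsum_inj s (u : 'rV[R[i]]_(d s)) : H := HSum (single_square_summable u).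

Lemma block_inj s (u : 'rV[R[i]]_(d s)) : block s (hsum_inj u) = u.
Proof. exact: dfwith_in. Qed.

Lemma hsq_inj_le s (u : 'rV[R[i]]_(d s)) : hsq (hsum_inj u) <= sqn u.
Proof. by apply: hsq_le => A; exact: fsum_single. Qed.

Lemma sumnorm_hsq n (v : 'cV[H]_n) : sumnorm v = Num.sqrt (\sum_i hsq (v i 0)).
Proof.
rewrite /sumnorm; congr Num.sqrt; apply: eq_bigr => i _.
by rewrite hsum_normE /= sqr_sqrtr// hsq_ge0.
Qed.

End hilbert_sum_injections.

Section universal_representation.
Variables (R : realType) (E : lmodType R[i]) (p : forall n, 'M[E]_n -> R).
Hypothesis hp : matrix_seminorm p.

(** The index set of the Hilbert sum that carries the universal representation. *)
Record mxrep := MxRep {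
  mxrep_dim : nat ;
  mxrep_fun : E -> 'M[R[i]]_mxrep_dim ;
  mxrepP : complete_contraction p mxrep_fun }.

HB.instance Definition _ := gen_eqMixin mxrep.
HB.instance Definition _ := gen_choiceMixin mxrep.

Let H := @hsum R mxrep mxrep_dim.

(** The estimate holds in each summand, hence for finite partial sums, and passes to
the limit. *)
Lemma mxrep_sum_le r (x : 'M[E]_r) (v w : 'I_r -> H) : (0 < r)%N ->
    (forall i s, block s (w i) = mxapp (mxrep_fun s) x (fun j => block s (v j)) i) ->
  \sum_i hsq (w i) <= p x ^+ 2 * \sum_j hsq (v j).
Proof.
move=> r0 wE.
have cv : \sum_i fsum (fun s => sqn (block s (w i))) A @[A --> totally] --> \sum_i hsq (w i).
  by apply: cvg_sumr => i; exact: has_fsum_hsq.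
apply: (cvg_le_bound cv); exists fset0 => // A _ /=.
have -> : \sum_i fsum (fun s => sqn (block s (w i))) A =
    \sum_(s <- A) \sum_i sqn (block s (w i)) by rewrite exchange_big.
apply: (@le_trans _ _ (\sum_(s <- A) p x ^+ 2 * \sum_j sqn (block s (v j)))).
  apply: ler_sum => s _; have [_ /(_ r x (fun j => block s (v j)) r0)] := mxrepP s.
  by apply: le_trans; apply: ler_sum => i _; rewrite wE.
rewrite -mulr_sumr ler_wpM2l ?sqr_ge0// exchange_big/=.
by apply: ler_sum => j _; exact: fsum_le_hsq.
Qed.

Lemma mxrep_square_summable (x : E) (f : H) :
  ((fun s => block s f *m mxrep_fun s x) : lmodProd _) \in
    @square_summable R mxrep mxrep_dim.
Proof.
apply/asboolP; exists (p (const_mx x : 'M_1) ^+ 2 * hsq f) => A.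
apply: (@le_trans _ _ (\sum_(s <- A) p (const_mx x : 'M_1) ^+ 2 * sqn (block s f))).
  apply: ler_sum => s _; have [_] := mxrepP s.
  move=> /(_ 1%N (const_mx x) (fun=> block s f) isT).
  by rewrite /mxapp 3!big_ord1 mxE.
rewrite -mulr_sumr ler_wpM2l ?sqr_ge0//; exact: fsum_le_hsq.
Qed.

Definition mxrep_diag (x : E) (f : H) : H := HSum (mxrep_square_summable x f).

Lemma mxrep_diag_bounded x : mxrep_diag x \in @bounded_linear R H.
Proof.
apply/asboolP; split.
  by move=> a f g; apply: hsum_ext => s; rewrite /block/= mulmxDl -scalemxAl.
exists (real_complex R (p (const_mx x : 'M_1))) => f.
rewrite !hsum_normE -rmorphM lecR.
have p0 : 0 <= p (const_mx x : 'M_1) by exact: (mxsn_ge0 hp).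
rewrite -[X in X * _]ger0_norm// -sqrtr_sqr -sqrtrM ?sqr_ge0// ler_sqrt; last first.
  by rewrite mulr_ge0 ?sqr_ge0 ?hsq_ge0.
have blockE (i : 'I_1) s : block s (mxrep_diag x f) =
    mxapp (mxrep_fun s) (const_mx x) (fun=> block s f) i.
  by rewrite /mxapp big_ord1 mxE.
have sum1 (a : R) : a = \sum_(i < 1) a by rewrite big_ord1.
rewrite [leLHS]sum1 [X in _ * X]sum1.
exact: (@mxrep_sum_le 1 _ (fun=> f) (fun=> mxrep_diag x f) isT blockE).
Qed.

Definition mxrep_op (x : E) : boundedOp H := BoundedOp (mxrep_diag_bounded x).

Lemma mxrep_op_linear : linear mxrep_op.
Proof.
move=> a x y; apply/val_inj/funext => f; apply: hsum_ext => s.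
have [lin _] := mxrepP s.
by rewrite /block/= lin mulmxDr -scalemxAr.
Qed.

(** The norm is at most p x by [mxrep_sum_le], and at least p x by evaluating at
vectors supported in the single summand given by
[norming_complete_contraction]. *)
Theorem mxrep_op_isometry n (x : 'M[E]_n) : (0 < n)%N ->
  boundedOp_mxnorm (map_mx mxrep_op x) = p x.
Proof.
move=> n0; rewrite /boundedOp_mxnorm /opnorm.
have px : 0 <= p x by exact: (mxsn_ge0 hp).
pose T := boundedOp_mx_app (map_mx mxrep_op x).
have Tblock (v : 'cV[H]_n) i s : block s (T v i 0) =
    mxapp (mxrep_fun s) x (fun j => block s (v j 0)) i.
  by rewrite mxE block_sum; apply: eq_bigr => j _; rewrite mxE.
have T_le v : sumnorm v <= 1 -> sumnorm (T v) <= p x.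
  rewrite !sumnorm_hsq => v1.
  have v1' : \sum_i hsq (v i 0) <= 1 by move: v1; rewrite -[X in _ <= X]sqrtr1 ler_sqrt.
  rewrite -[p x]ger0_norm// -sqrtr_sqr ler_sqrt ?sqr_ge0//.
  have := mxrep_sum_le n0 (fun i s => Tblock v i s).
  by move=> /le_trans; apply; rewrite ler_piMr ?sqr_ge0.
have [phi phi_cc [eta eta1 eta_x]] := norming_complete_contraction hp x n0.
pose s0 := MxRep phi_cc; pose v : 'cV[H]_n := \col_j @hsum_inj R mxrep mxrep_dim s0 (eta j).
have v1 : sumnorm v <= 1.
  rewrite sumnorm_hsq -[X in _ <= X]sqrtr1 ler_sqrt//; apply: le_trans eta1.
  by apply: ler_sum => j _; rewrite mxE; exact: hsq_inj_le.
have Tv : p x <= sumnorm (T v).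
  rewrite sumnorm_hsq -[p x]ger0_norm// -sqrtr_sqr ler_sqrt; last first.
    by apply: sumr_ge0 => i _; exact: hsq_ge0.
  apply: (le_trans eta_x); apply: ler_sum => i _.
  apply: le_trans (sqn_le_hsq _ s0); rewrite -/(block s0 _) Tblock.
  by rewrite /mxapp; under [in leRHS]eq_bigr do rewrite mxE block_inj.
have Tub : has_ubound [set sumnorm (T v) | v in [set v | sumnorm v <= 1]].
  by exists (p x) => _ [w w1 <-]; exact: T_le.
apply/le_anti/andP; split.
  apply: ge_sup; first by exists (sumnorm (T v)), v.
  by move=> _ [w w1 <-]; exact: T_le.
by apply: (le_trans Tv); apply: ub_le_sup => //; exists v.
Qed.

End universal_representation.

Theorem theorem0p2 (R : realType) (E : tvsType R[i]) (Lambda : Type)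
    (p : Lambda -> forall n, 'M[E]_n -> R) (hp : local_operator_space p) :
  exists (H : Lambda -> hilbertType R) (phi : {linear E -> boundedOpProd H}),
    injective phi /\
    forall (alpha : Lambda) (n : nat) (x : 'M[E]_n), (0 < n)%N ->
      rho alpha (map_mx phi x) = p alpha n x.
Proof.
have pm := los_mxsn hp.
pose H alpha : hilbertType R := @hsum R (mxrep (p alpha)) (@mxrep_dim R E (p alpha)).
pose phi0 x : boundedOpProd H := fun alpha => mxrep_op (pm alpha) x.
have phi_lin : linear phi0.
  move=> a x y; apply: functional_extensionality_dep => alpha.
  exact: mxrep_op_linear.
pose phi := linear_of phi_lin.
have phi_iso alpha n (x : 'M[E]_n) : (0 < n)%N -> rho alpha (map_mx phi x) = p alpha n x.
  move=> n0; rewrite -(mxrep_op_isometry (pm alpha) x n0) /rho.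
  by congr (boundedOp_mxnorm _); apply/matrixP => i j; rewrite !mxE.
exists H, phi; split=> // x y xy; apply/subr0_eq/(los_separating hp) => alpha.
have xy0 : phi (x - y) = phi 0 by rewrite linearB linear0 xy subrr.
have cE (z : E) : map_mx phi (const_mx z : 'M_1) = const_mx (phi z).
  by apply/matrixP => i j; rewrite !mxE.
rewrite -phi_iso// cE xy0 -cE phi_iso//.
by rewrite [const_mx 0](_ : _ = 0) ?(mxsn0 (pm alpha)).
Qed.
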